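(* Let $E$ be a Banach lattice not isomorphic to an AL-space and let $1<p<\infty$. Then $\ell^\pi_p(E)\setminus\ell_p\langle E\rangle$ is completely latticeable in $\ell^\pi_p(E)$.
   Context: Complete latticeability. A subset $A$ of a Banach lattice $X$ is completely latticeable (in $X$) if there is a closed infinite dimensional sublattice (Riesz subspace) of $X$ all of whose elements but the origin belong to $A$. An AL-space is a Banach lattice whose norm satisfies $\|x+y\|=\|x\|+\|y\|$ for all $x,y\geq0$. Vector-valued sequence spaces. Let $1<p<\infty$, $1/p+1/p'=1$, and let $E$ be a Banach lattice. $B_X$ is the closed unit ball of $X$, $X^+$ the positive cone, $B_{X^+}=B_X\cap X^+$. Define $$(\ell_p)'_w(E^* )=\{(x^*_j)_j\in(E^* )^{\mathbb{N}}:(x^*_j(x))_j\in\ell_{p'}\ \text{for every }x\in E\},$$ $$\ell_p\langle E\rangle=\Big\{(x_j)_j\in E^{\mathbb{N}}:\sum_{j=1}^\infty|x^*_j(x_j)|<\infty\ \text{for every }(x^*_j)_j\in(\ell_p)'_w(E^* )\Big\}$$ (the space of Cohen strongly $p$-summable sequences), $$(\ell_p)'_\varepsilon(E^* )=\{(x^*_j)_j\in(E^* )^{\mathbb{N}}:(|x^*_j|(x))_j\in\ell_{p'}\ \text{for every }x\in E^+\},\quad \|(x^*_j)_j\|_\varepsilon=\sup_{x\in B_{E^+}}\|(|x^*_j|(x))_j\|_{p'},$$ $$\ell_p^\pi(E)=\Big\{(x_j)_j\in E^{\mathbb{N}}:\sum_{j=1}^\infty x^*_j(|x_j|)<\infty\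 \text{for every }(x^*_j)_j\in(\ell_p)'_\varepsilon(E^* )^+\Big\},$$ $$\|(x_j)_j\|_\pi=\sup_{(x^*_j)_j\in B_{(\ell_p)'_\varepsilon(E^* )^+}}\sum_{j=1}^\infty x^*_j(|x_j|).$$ The space $\ell_p^\pi(E)$ is a Banach lattice with the coordinatewise order and the norm $\|\cdot\|_\pi$, and $\ell_p\langle E\rangle$ is a linear subspace of it. *)

(* Defs.v *)
From HB Require Import structures.
From mathcomp Require Import all_boot all_order all_algebra.
From mathcomp Require Import all_classical all_reals all_analysis.

Set Implicit Arguments.
Unset Strict Implicit.
Unset Printing Implicit Defensive.

Import Order.TTheory GRing.Theory Num.Theory.
Import numFieldNormedType.Exports.

Local Open Scope classical_set_scope.
Local Open Scope ring_scope.

Reserved Notation "x <=v y" (at level 70, y at next level).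

(* The order and the lattice operations are fields of this mixin: the
   hierarchy has no join of the library's ordered types with its normed
   modules, and does not admit one. *)
HB.mixin Record Lmodule_isRiesz (R : realType) V of GRing.Lmodule R V := {
  rle : V -> V -> Prop;
  rjoin : V -> V -> V;
  rmeet : V -> V -> V;
  rle_refl : forall x : V, rle x x;
  rle_anti : forall x y : V, rle x y -> rle y x -> x = y;
  rle_trans : forall y x z : V, rle x y -> rle y z -> rle x z;
  rjoin_le : forall x y z : V, rle (rjoin x y) z <-> rle x z /\ rle y z;
  le_rmeet : forall x y z : V, rle z (rmeet x y) <-> rle z x /\ rle z y;
  rleD2r : forall x y z : V, rle x y -> rle (x + z) (y + z);
  rle_scale_ge0 : forall (a : R) (x : V), 0 <= a -> rle 0 x -> rle 0 (a *: x)
}.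

#[short(type="rieszType")]
HB.structure Definition Riesz (R : realType) :=
  {V of GRing.Lmodule R V & Lmodule_isRiesz R V}.

Notation "x <=v y" := (rle x y) : ring_scope.

Definition modulus (R : realType) (V : rieszType R) (x : V) : V :=
  rjoin x (- x).

HB.mixin Record Riesz_CompleteNormedModule_isBanachLattice (R : realType) E
    of Riesz R E & CompleteNormedModule R E := {
  norm_modulus_le : forall x y : E, modulus x <=v modulus y -> `|x| <= `|y|
}.

#[short(type="banachLatticeType")]
HB.structure Definition BanachLattice (R : realType) :=
  {E of Riesz R E & CompleteNormedModule R E &
        Riesz_CompleteNormedModule_isBanachLattice R E}.

Section fun_riesz.
Variables (R : realType) (I : Type) (V : rieszType R).

Let le (x y : I -> V) : Prop := forall i, x i <=v y i.
Let join (x y : I -> V) : I -> V := fun i => rjoin (x i) (y i).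
Let meet (x y : I -> V) : I -> V := fun i => rmeet (x i) (y i).

Let le_refl x : le x x.
Proof. by move=> i; exact: rle_refl. Qed.

Let le_anti x y : le x y -> le y x -> x = y.
Proof. by move=> xy yx; apply/funext => i; exact: rle_anti. Qed.

Let le_trans y x z : le x y -> le y z -> le x z.
Proof. by move=> xy yz i; exact: rle_trans (xy i) (yz i). Qed.

Let join_le x y z : le (join x y) z <-> le x z /\ le y z.
Proof.
split=> [h|[xz yz] i]; last by apply/rjoin_le; split.
by split=> i; have /rjoin_le[] := h i.
Qed.

Let le_meet x y z : le z (meet x y) <-> le z x /\ le z y.
Proof.
split=> [h|[zx zy] i]; last by apply/le_rmeet; split.
by split=> i; have /le_rmeet[] := h i.
Qed.

Let leD2r x y z : le x y -> le (x + z) (y + z).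
Proof. by move=> xy i; exact: rleD2r. Qed.

Let le_scale_ge0 (a : R) x : 0 <= a -> le 0 x -> le 0 (a *: x).
Proof. by move=> a0 x0 i; exact: rle_scale_ge0 (x0 i). Qed.

HB.instance Definition _ := @Lmodule_isRiesz.Build R (I -> V) le join meet
  le_refl le_anti le_trans join_le le_meet leD2r le_scale_ge0.

End fun_riesz.

Definition AL_space (R : realType) (F : banachLatticeType R) : Prop :=
  forall x y : F, 0 <=v x -> 0 <=v y -> `|x + y| = `|x| + `|y|.

(* A linear homeomorphism that preserves the lattice operations; it need not
   be isometric. *)
Definition lattice_isomorphic (R : realType) (E F : banachLatticeType R) :
    Prop :=
  exists T : {linear E -> F}, exists S : F -> E,
    [/\ cancel T S /\ cancel S T,
        continuous T /\ continuous S,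
        {morph T : x y / rjoin x y} &
        {morph T : x y / rmeet x y}].

Definition isomorphic_to_AL_space (R : realType) (E : banachLatticeType R) :
    Prop :=
  exists F : banachLatticeType R, AL_space F /\ lattice_isomorphic E F.

Section complete_latticeability.
Context {R : realType} {V : rieszType R}.

Definition riesz_subspace (L : set V) : Prop :=
  [/\ L 0,
      forall (a : R) x y, L x -> L y -> L (a *: x + y),
      forall x y, L x -> L y -> L (rjoin x y) &
      forall x y, L x -> L y -> L (rmeet x y)].

Definition finite_dimensional (L : set V) : Prop :=
  exists n : nat, exists b : 'I_n -> V,
    (forall i, L (b i)) /\
    forall x, L x -> exists c : 'I_n -> R, x = \sum_(i < n) c i *: b i.

Definition norm_closed_in (X : set V) (N : V -> \bar R) (L : set V) : Prop :=
  forall x, X x ->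
    (forall e : R, 0 < e -> exists2 y, L y & (N (x - y)%R < e%:E)%E) -> L x.

(* The Banach lattice is given by its underlying Riesz subspace [X] of [V]
   together with its norm [N], which need only be meaningful on [X]. *)
Definition completely_latticeable
    (X : set V) (N : V -> \bar R) (A : set V) : Prop :=
  exists L : set V,
    [/\ L `<=` X,
        riesz_subspace L,
        norm_closed_in X N L,
        ~ finite_dimensional L &
        forall x, L x -> x <> 0 -> A x].

End complete_latticeability.

Section topological_dual.
Context {R : realType} {E : banachLatticeType R}.

Definition dual : set (E -> R^o) := [set f | linear f /\ continuous f].

(* The order of the dual, not the pointwise order of functions on [E]. *)
Definition dual_le (f g : E -> R^o) : Prop :=
  forall x : E, 0 <=v x -> f x <= g x.

Definition is_dual_abs (f g : E -> R^o) : Prop :=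
  [/\ dual g, dual_le f g, dual_le (- f) g &
      forall h, dual h -> dual_le f h -> dual_le (- f) h -> dual_le g h].

(* On [dual] the supremum of [f] and [- f] exists and is unique, so that the
   default value [f] is not used. *)
Definition dual_abs (f : E -> R^o) : E -> R^o := xget f (is_dual_abs f).

End topological_dual.

Definition lnorm (R : realType) (r : \bar R) (a : nat -> R) : \bar R :=
  Lnorm counting r (EFin \o a).

Definition lspace (R : realType) (r : \bar R) : set (nat -> R) :=
  [set a | (lnorm r a < +oo)%E].

Section vector_valued_sequences.
Context {R : realType}.
Variables (p : R) (E : banachLatticeType R).

Local Notation p' := (hoelder_conjugate p%:E).

Definition dual_weak : set (nat -> E -> R^o) :=
  [set f | (forall j, dual (f j)) /\
           forall x : E, lspace p' (fun j => f j x)].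

Definition cohen : set (nat -> E) :=
  [set x | forall f, dual_weak f ->
             (\sum_(0 <= j <oo) `|f j (x j)|%:E < +oo)%E].

Definition dual_eps : set (nat -> E -> R^o) :=
  [set f | (forall j, dual (f j)) /\
           forall x : E, 0 <=v x -> lspace p' (fun j => dual_abs (f j) x)].

Definition eps_norm (f : nat -> E -> R^o) : \bar R :=
  ereal_sup [set lnorm p' (fun j => dual_abs (f j) x) |
             x in [set x : E | 0 <=v x /\ `|x| <= 1]].

Definition dual_eps_pos : set (nat -> E -> R^o) :=
  [set f | dual_eps f /\ forall j, dual_le 0 (f j)].

Definition pi_sum (f : nat -> E -> R^o) (x : nat -> E) : \bar R :=
  (\sum_(0 <= j <oo) (f j (modulus (x j)))%:E)%E.

Definition lpi : set (nat -> E) :=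
  [set x | forall f, dual_eps_pos f -> (pi_sum f x < +oo)%E].

Definition pi_norm (x : nat -> E) : \bar R :=
  ereal_sup [set pi_sum f x |
             f in [set f | dual_eps_pos f /\ (eps_norm f <= 1)%E]].

End vector_valued_sequences.

Arguments cohen {R} p E _.
Arguments lpi {R} p E _.
Arguments pi_norm {R} p E _.

(* Main.v *)
(* Idea of the proof.
   If [E] is not isomorphic to an AL-space then, for every [C], there are
   functionals [psi_i] with [\sum_i psi_i(v)^2 <= |v|^2] and [x_i >= 0] with
   [|\sum_i x_i| <= 1] and [\sum_i psi_i(x_i) > C].  Otherwise, applying the
   reverse bound to functionals adapted to disjoint [y_i], the best constant [K]
   in [\sum_i |y_i| <= K |\sum_i y_i|] satisfies [K <= C sqrt K]; disjoint
   positive families have the same best constant as arbitrary ones, so [K] is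
   bounded in the number of vectors, and Hahn-Banach then yields a positive
   functional equivalent to the norm on the cone, i.e. an equivalent AL-norm.
   By Khintchine's inequality, the operators [g_e = \sum_i e_i psi_i] indexed by
   the signs [e], suitably normalized, form an operator into [l_p'] of norm at
   most [1], while [u_e = \sum_(e_i = 1) x_i <= \sum_i x_i] has small norm in
   [l_p^pi(E)] and large pairing with [g].  Gluing such blocks gives a positive
   [u] in [l_p^pi(E)] that is not Cohen strongly summable, and the sequences
   indexed by [nat * nat] all of whose rows are multiples of [u] form the
   required sublattice. *)

Require Import Defs.
From HB Require Import structures.
From mathcomp Require Import all_boot all_order all_algebra.
From mathcomp Require Import all_classical all_reals all_analysis.
From mathcomp Require Import ring lra.

Set Implicit Arguments.
Unset Strict Implicit.
Unset Printing Implicit Defensive.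

Import Order.TTheory GRing.Theory Num.Theory.
Import numFieldNormedType.Exports.

Local Open Scope classical_set_scope.
Local Open Scope ring_scope.

(** * Riesz spaces and Banach lattices *)

Section riesz_space.
Variables (R : realType) (V : rieszType R).
Implicit Types x y z t u v w : V.

Lemma rleD x y z t : x <=v y -> z <=v t -> x + z <=v y + t.
Proof.
move=> xy zt; apply: (@rle_trans _ _ (y + z)); first exact: rleD2r.
by rewrite ![y + _]addrC; exact: rleD2r.
Qed.

Lemma rle_subLR x y z : x - y <=v z <-> x <=v y + z.
Proof.
split=> [/(@rleD2r _ _ _ _ y)|/(@rleD2r _ _ _ _ (- y))].
  by rewrite subrK addrC.
by rewrite addrAC subrr add0r.
Qed.

Lemma rsubr_ge0 x y : 0 <=v y - x <-> x <=v y.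
Proof.
split=> [/(@rleD2r _ _ _ _ x)|/(@rleD2r _ _ _ _ (- x))].
  by rewrite add0r subrK.
by rewrite subrr.
Qed.

Lemma rleN x y : x <=v y -> - y <=v - x.
Proof. by move/rsubr_ge0 => h; apply/rsubr_ge0; rewrite opprK addrC. Qed.

Lemma rleDl x y : 0 <=v y -> x <=v x + y.
Proof.
by move=> y0; rewrite -[x in x <=v _]addr0; apply: rleD y0; exact: rle_refl.
Qed.

Lemma raddr_ge0 x y : 0 <=v x -> 0 <=v y -> 0 <=v x + y.
Proof. by move=> x0 y0; rewrite -[0]addr0; exact: rleD. Qed.

Lemma rle_scale (a : R) x y : 0 <= a -> x <=v y -> a *: x <=v a *: y.
Proof.
move=> a0 /rsubr_ge0 xy; apply/rsubr_ge0.
by rewrite -scalerBr; exact: rle_scale_ge0.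
Qed.

Lemma rle_scalel (a b : R) x : a <= b -> 0 <=v x -> a *: x <=v b *: x.
Proof.
move=> ab x0; apply/rsubr_ge0; rewrite -scalerBl.
by apply: rle_scale_ge0 => //; rewrite subr_ge0.
Qed.

Lemma rsum_ge0 (I : Type) (s : seq I) (P : pred I) (F : I -> V) :
  (forall i, P i -> 0 <=v F i) -> 0 <=v \sum_(i <- s | P i) F i.
Proof.
move=> F0; apply: (big_ind (fun x => 0 <=v x)) => //; first exact: rle_refl.
exact: raddr_ge0.
Qed.

Lemma rle_sum (I : Type) (s : seq I) (P : pred I) (F G : I -> V) :
  (forall i, P i -> F i <=v G i) ->
  \sum_(i <- s | P i) F i <=v \sum_(i <- s | P i) G i.
Proof.
move=> FG; apply: (big_ind2 (fun x y => x <=v y)) => //.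
  exact: rle_refl.
by move=> *; exact: rleD.
Qed.

Lemma rjoin_l x y : x <=v rjoin x y.
Proof. by have /rjoin_le[] := rle_refl (rjoin x y). Qed.

Lemma rjoin_r x y : y <=v rjoin x y.
Proof. by have /rjoin_le[] := rle_refl (rjoin x y). Qed.

Lemma rmeet_l x y : rmeet x y <=v x.
Proof. by have /le_rmeet[] := rle_refl (rmeet x y). Qed.

Lemma rmeet_r x y : rmeet x y <=v y.
Proof. by have /le_rmeet[] := rle_refl (rmeet x y). Qed.

Lemma rmeet_ge0 x y : 0 <=v x -> 0 <=v y -> 0 <=v rmeet x y.
Proof. by move=> x0 y0; apply/le_rmeet. Qed.

Lemma rjoin_ler x y : x <=v y -> rjoin x y = y.
Proof.
move=> xy; apply: rle_anti; last exact: rjoin_r.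
by apply/rjoin_le; split=> //; exact: rle_refl.
Qed.

Lemma rjoin_lel x y : y <=v x -> rjoin x y = x.
Proof.
move=> xy; apply: rle_anti; last exact: rjoin_l.
by apply/rjoin_le; split=> //; exact: rle_refl.
Qed.

Lemma rmeet_lel x y : x <=v y -> rmeet x y = x.
Proof.
move=> xy; apply: rle_anti; first exact: rmeet_l.
by apply/le_rmeet; split=> //; exact: rle_refl.
Qed.

Lemma rmeet_ler x y : y <=v x -> rmeet x y = y.
Proof.
move=> xy; apply: rle_anti; first exact: rmeet_r.
by apply/le_rmeet; split=> //; exact: rle_refl.
Qed.

(** * Positive parts and disjointness *)

Definition rpos x := rjoin x 0.

Lemma rpos_ge0 x : 0 <=v rpos x. Proof. exact: rjoin_r. Qed.

Lemma rle_rpos x : x <=v rpos x. Proof. exact: rjoin_l. Qed.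

Lemma rpos_le x y : rpos x <=v y <-> x <=v y /\ 0 <=v y.
Proof. exact: rjoin_le. Qed.

Lemma rpos_id x : 0 <=v x -> rpos x = x.
Proof. exact: rjoin_lel. Qed.

Lemma rpos_homo x y : x <=v y -> rpos x <=v rpos y.
Proof.
move=> xy; apply/rpos_le; split; last exact: rpos_ge0.
exact: rle_trans xy (rle_rpos y).
Qed.

Lemma rposD x y : rpos (x + y) <=v rpos x + rpos y.
Proof.
apply/rpos_le; split; first by apply: rleD; exact: rle_rpos.
by apply: raddr_ge0; exact: rpos_ge0.
Qed.

Lemma rposZ_le (a : R) x : 0 <= a -> rpos (a *: x) <=v a *: rpos x.
Proof.
move=> a0; apply/rpos_le; split; first by apply: rle_scale => //; exact: rle_rpos.
by apply: rle_scale_ge0 => //; exact: rpos_ge0.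
Qed.

Lemma rposN x : rpos (- x) = rpos x - x.
Proof.
apply: rle_anti.
  apply/rpos_le; split; last by apply/rsubr_ge0; exact: rle_rpos.
  by rewrite addrC; apply: rleDl; exact: rpos_ge0.
apply/rle_subLR/rpos_le; split; first by apply: rleDl; exact: rpos_ge0.
by rewrite -[X in X <=v _](subrr x); apply: rleD; [exact: rle_refl|exact: rle_rpos].
Qed.

Lemma rpos_sub x : x = rpos x - rpos (- x).
Proof. by rewrite rposN opprB addrC subrK. Qed.

(** Cutting [x] off at [y] loses at most [(x - y)^+], because [x - (x - y)^+] lies below both [x]
    and [y]. *)
Lemma rle_meet_pos x y : x <=v rmeet x y + rpos (x - y).
Proof.
rewrite addrC; apply/rle_subLR/le_rmeet; split.
  by apply/rle_subLR; rewrite addrC; apply: rleDl; exact: rpos_ge0.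
apply/rle_subLR; rewrite -[x in x <=v _](subrK y).
by apply: rleD2r; exact: rle_rpos.
Qed.

(** For positive elements this is the usual [rmeet x y = 0]; the inequality is inherited by smaller
    elements. *)
Definition rdisj x y := rmeet x y <=v 0.

Lemma rdisjP x y : rdisj x y <-> forall z, z <=v x -> z <=v y -> z <=v 0.
Proof.
split=> [xy z zx zy|h].
  by apply: rle_trans xy; apply/le_rmeet.
by apply: h; [exact: rmeet_l|exact: rmeet_r].
Qed.

Lemma rdisjC x y : rdisj x y -> rdisj y x.
Proof. by move=> /rdisjP h; apply/rdisjP => z zx zy; exact: h. Qed.

Lemma rdisj_le x y u v : u <=v x -> v <=v y -> rdisj x y -> rdisj u v.
Proof.
move=> ux vy /rdisjP h; apply/rdisjP => z zu zv.
by apply: h; [exact: rle_trans zu ux|exact: rle_trans zv vy].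
Qed.

(** If [z] is below both parts, then [rpos x - z] is positive and, as [rpos (- x) = rpos x - x],
    dominates [x]. It then dominates [rpos x], so [z <=v 0]. *)
Lemma rdisj_pos x : rdisj (rpos x) (rpos (- x)).
Proof.
apply/rdisjP => z; rewrite rposN => h1 h2.
have : rpos x <=v rpos x - z.
  apply/rpos_le; split; last exact/rsubr_ge0.
  apply/rsubr_ge0; move/rsubr_ge0 : h2.
  by rewrite addrAC.
move/(@rleD2r _ _ _ _ (z - rpos x)).
by rewrite addrC subrK addrA subrK subrr.
Qed.

(** A common lower bound [v] of [x] and [y + z] has [v - z] below [x] and [y], so [v <=v z];
    disjointness of [x] and [z] concludes. *)
Lemma rdisjD x y z : 0 <=v z -> rdisj x y -> rdisj x z -> rdisj x (y + z).
Proof.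
move=> z0 /rdisjP xy /rdisjP xz; apply/rdisjP => v vx vyz.
apply: xz => //; rewrite -[z]addr0; apply/rle_subLR; apply: xy.
  apply: rle_trans vx; apply/rle_subLR; rewrite addrC; exact: rleDl.
by apply/rle_subLR; rewrite addrC.
Qed.

(** Since [x + y - w] is below both [x] and [y], it is at most [0]. *)
Lemma rdisj_addr_le x y w : x <=v w -> y <=v w -> rdisj x y -> x + y <=v w.
Proof.
move=> xw yw /rdisjP xy; rewrite -[w]addr0; apply/rle_subLR; apply: xy.
  by apply/rle_subLR; rewrite addrC; apply: rleD2r.
by apply/rle_subLR; apply: rleD2r.
Qed.

Lemma rdisj_sum_le n (y : nat -> V) w :
  0 <=v w -> (forall i, 0 <=v y i) -> (forall i, (i < n)%N -> y i <=v w) ->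
  (forall i k, (i < k)%N -> rdisj (y i) (y k)) -> \sum_(i < n) y i <=v w.
Proof.
move=> w0 y0; elim: n => [|n IH] yw yy; first by rewrite big_ord0.
rewrite big_ord_recr /=; apply: rdisj_addr_le.
- by apply: IH => // i /ltnW; exact: yw.
- exact: yw.
- apply: rdisjC.
  have : forall m, (m <= n)%N -> rdisj (y n) (\sum_(i < m) y i).
    elim=> [|m IHm] mn.
      by rewrite big_ord0; apply: rmeet_r.
    rewrite big_ord_recr /=; apply: rdisjD => //; first exact/IHm/ltnW.
    exact/rdisjC/yy.
  exact.
Qed.

(** * The modulus *)

Lemma rle_modulus x : x <=v modulus x. Proof. exact: rjoin_l. Qed.

Lemma rleN_modulus x : - x <=v modulus x. Proof. exact: rjoin_r. Qed.

Lemma modulus_le x y : modulus x <=v y <-> x <=v y /\ - x <=v y.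
Proof. exact: rjoin_le. Qed.

Lemma modulus_ge0 x : 0 <=v modulus x.
Proof.
have h := rleD (rle_modulus x) (rleN_modulus x).
rewrite subrr -mulr2n -scaler_nat in h.
have := @rle_scale 2^-1 _ _ _ h; rewrite scaler0 scalerA mulVf ?scale1r//.
by apply; rewrite invr_ge0.
Qed.

Lemma modulus_id x : 0 <=v x -> modulus x = x.
Proof.
move=> x0; apply: rjoin_lel; apply: (@rle_trans _ _ 0) => //.
by move: (rleN x0); rewrite oppr0.
Qed.

Lemma modulusN x : modulus (- x) = modulus x.
Proof.
have h y : modulus (- y) <=v modulus y.
  by apply/modulus_le; rewrite opprK; split; [exact: rleN_modulus|exact: rle_modulus].
by apply: rle_anti => //; rewrite -{1}[x]opprK.
Qed.

Lemma modulusD x y : modulus (x + y) <=v modulus x + modulus y.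
Proof.
apply/modulus_le; rewrite opprD.
by split; apply: rleD; by [exact: rle_modulus|exact: rleN_modulus].
Qed.

Lemma modulus0 : modulus (0 : V) = 0.
Proof. by apply: modulus_id; exact: rle_refl. Qed.

Lemma modulusZ (a : R) x : modulus (a *: x) = `|a| *: modulus x.
Proof.
have pos b y : 0 <= b -> modulus (b *: y) <=v b *: modulus y.
  move=> b0; apply/modulus_le; rewrite -scalerN.
  by split; apply: rle_scale => //; [exact: rle_modulus|exact: rleN_modulus].
have E b y : 0 < b -> modulus (b *: y) = b *: modulus y.
  move=> b0; apply: rle_anti; first exact/pos/ltW.
  have := @rle_scale b _ _ (ltW b0) (@pos b^-1 (b *: y) _).
  rewrite !scalerA mulVf ?gt_eqF// mulfV ?gt_eqF// !scale1r.
  by apply; rewrite invr_ge0 ltW.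
have [a0|a0|->] := ltgtP a 0.
- by rewrite -modulusN -scaleNr E ?oppr_gt0// ltr0_norm.
- by rewrite E// gtr0_norm.
- by rewrite normr0 !scale0r modulus0.
Qed.

Lemma modulus_rjoin x y : modulus (rjoin x y) <=v modulus x + modulus y.
Proof.
apply/modulus_le; split.
  apply/rjoin_le; split; first by apply: rle_trans (rle_modulus x) _;
    apply: rleDl; exact: modulus_ge0.
  by apply: rle_trans (rle_modulus y) _; rewrite addrC; apply: rleDl; exact: modulus_ge0.
apply: rle_trans (rleN (rjoin_l x y)) _.
by apply: rle_trans (rleN_modulus x) _; apply: rleDl; exact: modulus_ge0.
Qed.

Lemma modulus_rmeet x y : modulus (rmeet x y) <=v modulus x + modulus y.
Proof.
apply/modulus_le; split.
  apply: rle_trans (rmeet_l x y) _.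
  by apply: rle_trans (rle_modulus x) _; apply: rleDl; exact: modulus_ge0.
suff: - (modulus x + modulus y) <=v rmeet x y.
  by move/rleN; rewrite opprK.
apply/le_rmeet; split; rewrite opprD.
- rewrite -[x in _ <=v x]addr0; apply: rleD.
    by rewrite -[x in _ <=v x]opprK; apply/rleN/rleN_modulus.
  by rewrite -oppr0; apply/rleN/modulus_ge0.
- rewrite -[y in _ <=v y]add0r; apply: rleD.
    by rewrite -oppr0; apply/rleN/modulus_ge0.
  by rewrite -[y in _ <=v y]opprK; apply/rleN/rleN_modulus.
Qed.

Lemma rjoin_scale (a b : R) x : 0 <=v x ->
  rjoin (a *: x) (b *: x) = Num.max a b *: x.
Proof.
move=> x0; have [ab|ba] := leP a b.
  by apply: rjoin_ler; exact: rle_scalel.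
by apply: rjoin_lel; apply: rle_scalel => //; exact: ltW.
Qed.

Lemma rmeet_scale (a b : R) x : 0 <=v x ->
  rmeet (a *: x) (b *: x) = Num.min a b *: x.
Proof.
move=> x0; have [ab|ba] := leP a b.
  by apply: rmeet_lel; exact: rle_scalel.
by apply: rmeet_ler; apply: rle_scalel => //; exact: ltW.
Qed.

End riesz_space.

Section banach_lattice_norm.
Variables (R : realType) (E : banachLatticeType R).
Implicit Types x y : E.

Lemma norm_homo x y : 0 <=v x -> x <=v y -> `|x| <= `|y|.
Proof.
move=> x0 xy; apply: norm_modulus_le.
by rewrite !modulus_id//; exact: rle_trans xy.
Qed.

Lemma norm_modulus x : `|modulus x| = `|x|.
Proof.
have h : modulus (modulus x) = modulus x by apply/modulus_id/modulus_ge0.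
by apply/eqP; rewrite eq_le; apply/andP; split; apply: norm_modulus_le;
  rewrite h; exact: rle_refl.
Qed.

Lemma rpos_le_modulus x : rpos x <=v modulus x.
Proof.
by apply/rpos_le; split; [exact: rle_modulus|exact: modulus_ge0].
Qed.

Lemma norm_rpos_le x : `|rpos x| <= `|x|.
Proof.
by rewrite -(norm_modulus x); apply: norm_homo (rpos_ge0 _) (rpos_le_modulus x).
Qed.

End banach_lattice_norm.

(** * The Hahn-Banach theorem *)

Lemma le_infD (R : realType) (A B : set R) (c : R) :
  A !=set0 -> B !=set0 -> (forall a b, A a -> B b -> c <= a + b) ->
  c <= inf A + inf B.
Proof.
move=> A0 B0 h; rewrite -lerBlDr; apply: lb_le_inf => // a Aa.
rewrite lerBlDr -lerBlDl; apply: lb_le_inf => // b Bb.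
by rewrite lerBlDl; exact: h.
Qed.

Section hahn_banach.
Variables (R : realType) (V : lmodType R).
Implicit Types (p q : V -> R) (x y : V).

(** Homogeneity as an inequality for [a > 0] suffices: applied to [a^-1] it gives equality, and
    [p 0 = 0] follows. *)
Definition sublinear p :=
  (forall x y, p (x + y) <= p x + p y) /\
  (forall (a : R) x, 0 < a -> p (a *: x) <= a * p x).

Lemma sublinearZ p (a : R) x : sublinear p -> 0 <= a -> p (a *: x) = a * p x.
Proof.
move=> [_ pZ]; have p0 : p 0 = 0.
  have := pZ 2 0 (ltr0Sn _ _); have := pZ 2^-1 0.
  by rewrite !scaler0 invr_gt0 => /(_ (ltr0Sn _ _)); lra.
rewrite le_eqVlt => /predU1P[<-|a0]; first by rewrite scale0r p0 mul0r.
apply/eqP; rewrite eq_le pZ//= -ler_pdivlMl//.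
have := pZ a^-1 (a *: x); rewrite scalerA mulVf ?gt_eqF// scale1r.
by apply; rewrite invr_gt0.
Qed.

Lemma sublinear0 p : sublinear p -> p 0 = 0.
Proof. by move=> sp; rewrite -(scale0r 0) sublinearZ// mul0r. Qed.

Lemma sublinear_ge p x : sublinear p -> - p (- x) <= p x.
Proof.
move=> sp; have [/(_ x (- x))] := sp; rewrite subrr (sublinear0 sp); lra.
Qed.

(** The reduction step of Hahn-Banach: sublinear, below [p], and at most [- p y] at [- y]. It serves
    both for the linearity of minimal functionals and for prescribing a value at one point. *)
Definition steepen p y x : R :=
  inf [set p (x + t *: y) - t * p y | t in [set t | 0 <= t]].

Let steepen_has_lb p y x : sublinear p ->
  has_lbound [set p (x + t *: y) - t * p y | t in [set t | 0 <= t]].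
Proof.
move=> sp; exists (- p (- x)) => _ [t /= t0 <-].
rewrite -sublinearZ// lerBrDl -lerBrDr opprK.
by case: sp => + _ => /(_ (x + t *: y) (- x)); rewrite addrAC subrr add0r.
Qed.

Let steepen_le p y x (t : R) : sublinear p -> 0 <= t ->
  steepen p y x <= p (x + t *: y) - t * p y.
Proof.
by move=> sp t0; apply: (ge_inf (steepen_has_lb y x sp)); exists t.
Qed.

Let steepen_neq0 p y x :
  [set p (x + t *: y) - t * p y | t in [set t | 0 <= t]] !=set0.
Proof. by exists (p (x + 0 *: y) - 0 * p y); exists 0 => /=. Qed.

Lemma steepen_sublinear p y : sublinear p -> sublinear (steepen p y).
Proof.
move=> sp; split=> [u v|a x a0].
  apply: le_infD => // _ _ [s /= s0 <-] [t /= t0 <-].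
  apply: (le_trans (@steepen_le p y (u + v) (s + t) sp _)); first exact: addr_ge0.
  rewrite scalerDl addrACA; case: sp => /(_ (u + s *: y) (v + t *: y)); lra.
rewrite -ler_pdivrMl//; apply: lb_le_inf => // _ [t /= t0 <-].
rewrite ler_pdivrMl//.
apply: (le_trans (@steepen_le p y (a *: x) (a * t) sp _)).
  by rewrite mulr_ge0// ltW.
by rewrite -scalerA -scalerDr (sublinearZ _ sp (ltW a0)) mulrBr mulrA.
Qed.

Lemma steepen_id_le p y x : sublinear p -> steepen p y x <= p x.
Proof.
by move=> sp; have := @steepen_le p y x 0 sp (lexx _); rewrite scale0r addr0 mul0r subr0.
Qed.

Lemma steepenN p y : sublinear p -> steepen p y (- y) <= - p y.
Proof.
move=> sp; have := @steepen_le p y (- y) 1 sp ler01.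
by rewrite scale1r addNr (sublinear0 sp) mul1r add0r.
Qed.

(** Zorn's lemma for the reversed pointwise order below [p]. A nonempty chain is bounded by its
    pointwise infimum, finite because each member is at least [- p (- x)] at [x]. *)
Lemma exists_minimal_sublinear p : sublinear p ->
  exists q, [/\ sublinear q, (forall x, q x <= p x) &
    forall r, sublinear r -> (forall x, r x <= q x) -> r = q].
Proof.
move=> sp; pose T := {q : V -> R | sublinear q /\ forall x, q x <= p x}.
pose le (q r : T) := `[< forall x, sval r x <= sval q x >].
have [||||[q [sq qp]] qmin] := @Zorn T le.
- by move=> q; apply/asboolP.
- move=> q r s /asboolP rq /asboolP sr; apply/asboolP => x.
  exact: le_trans (sr x) (rq x).
- move=> [q ?] [r ?] /asboolP /= rq /asboolP /= qr; apply: eq_exist.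
  by apply/funext => x; apply/eqP; rewrite eq_le rq qr.
- move=> A Atot; have [[q0 Aq0]|A0] := pselect (A !=set0); last first.
    by exists (exist _ p (conj sp (fun=> lexx _))) => s As; exfalso; apply: A0; exists s.
  pose B x := [set sval q x | q in A].
  have B0 x : B x !=set0 by exists (sval q0 x); exists q0.
  have Blb x : has_lbound (B x).
    exists (- p (- x)) => _ [[q [sq qp]] /= _ <-].
    by apply: le_trans (sublinear_ge x sq); rewrite lerN2.
  have Ble (q : T) x : A q -> inf (B x) <= sval q x.
    by move=> Aq; apply: ge_inf => //; exists q.
  have sB : sublinear (fun x => inf (B x)).
    split=> [u v|a x a0].
      apply: le_infD => // _ _ [q Aq <-] [r Ar <-].
      (* The smaller of the two comparable functionals bounds the infimum at [u + v]. *)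
      have [/asboolP qr|/asboolP qr] := Atot _ _ Aq Ar.
        apply: le_trans (Ble r _ Ar) _; case: (svalP r) => -[h _] _.
        by apply: le_trans (h _ _) _; rewrite lerD2r.
      apply: le_trans (Ble q _ Aq) _; case: (svalP q) => -[h _] _.
      by apply: le_trans (h _ _) _; rewrite lerD2l.
    rewrite -ler_pdivrMl//; apply: lb_le_inf => // _ [q Aq <-].
    rewrite ler_pdivrMl//; apply: le_trans (Ble q _ Aq) _.
    by case: (svalP q) => -[_ +] _; exact.
  have Bp x : inf (B x) <= p x.
    by apply: le_trans (Ble _ x Aq0) _; case: (svalP q0) => _; exact.
  by exists (exist _ (fun x => inf (B x)) (conj sB Bp)) => s As; apply/asboolP => x /=; exact: Ble.
- exists q; split=> // r sr rq.
  have rp x : r x <= p x by exact: le_trans (rq x) (qp x).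
  have := qmin (exist _ r (conj sr rp)).
  by move=> /(_ (asboolT rq)) [].
Qed.

(* A minimal sublinear functional equals its own steepening in each direction
   [y], i.e. [q x <= q (x + y) - q y]. *)
Lemma minimal_sublinear_linear q : sublinear q ->
  (forall r, sublinear r -> (forall x, r x <= q x) -> r = q) ->
  linear (q : V -> R^o).
Proof.
move=> sq qmin.
have qD x y : q (x + y) = q x + q y.
  apply/eqP; rewrite eq_le; case: (sq) => -> _ /=.
  have := qmin _ (steepen_sublinear y sq) (fun x => steepen_id_le y x sq).
  move=> /(congr1 (@^~ x)) <-.
  have := @steepen_le q y x 1 sq ler01.
  by rewrite scale1r mul1r lerBrDr.
have qN x : q (- x) = - q x.
  by apply/eqP; rewrite -subr_eq0 opprK -qD addNr sublinear0.
move=> a x y; rewrite qD; congr (_ + _).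
have [a0|/ltW a0] := leP 0 a; first exact: sublinearZ.
by rewrite -[a]opprK scaleNr qN sublinearZ ?oppr_ge0// scaleNr.
Qed.

(** A minimal [f] below the steepening in the direction [x0] has [f (- x0) <= - p x0], so linearity
    gives equality at [x0]. *)
Theorem hahn_banach p x0 : sublinear p ->
  exists f : V -> R^o, [/\ linear f, (forall x, f x <= p x) & f x0 = p x0].
Proof.
move=> sp; have [f [sf fp fmin]] := exists_minimal_sublinear (steepen_sublinear x0 sp).
have lf := minimal_sublinear_linear sf fmin.
exists f; split=> // [x|]; first exact: le_trans (fp x) (steepen_id_le _ _ sp).
apply/eqP; rewrite eq_le (le_trans (fp _) (steepen_id_le _ _ sp))/=.
have := le_trans (fp (- x0)) (steepenN x0 sp).
have := lf (-1) x0 0; rewrite addr0 (sublinear0 sf) addr0 scaleN1r => ->.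
by rewrite scaleN1r lerN2.
Qed.

End hahn_banach.

Section linear_functionals.
Variables (R : realType) (V : lmodType R) (f : V -> R).
Hypothesis lf : linear (f : V -> R^o).

Lemma linfunD x y : f (x + y) = f x + f y.
Proof. by have := lf 1 x y; rewrite !scale1r. Qed.

Lemma linfun0 : f 0 = 0.
Proof. by apply: (@addrI _ (f 0)); rewrite -linfunD !addr0. Qed.

Lemma linfunZ a x : f (a *: x) = a * f x.
Proof. by have := lf a x 0; rewrite !addr0 linfun0 addr0. Qed.

Lemma linfunN x : f (- x) = - f x.
Proof. by rewrite -scaleN1r linfunZ mulN1r. Qed.

Lemma linfunB x y : f (x - y) = f x - f y.
Proof. by rewrite linfunD linfunN. Qed.

Lemma linfun_sum (I : Type) (s : seq I) (P : pred I) (F : I -> V) :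
  f (\sum_(i <- s | P i) F i) = \sum_(i <- s | P i) f (F i).
Proof. exact: (big_morph f linfunD linfun0). Qed.

End linear_functionals.

Section positive_functionals.
Variables (R : realType) (E : banachLatticeType R) (f : E -> R).
Hypothesis lf : linear (f : E -> R^o).

Lemma bounded_dual (M : R) : (forall x, `|f x| <= M * `|x|) ->
  dual (f : E -> R^o).
Proof.
move=> fM; split=> //.
pose g : {linear E -> R^o} := HB.pack (f : E -> R^o)
  (GRing.isLinear.Build R E R^o *:%R f lf).
apply: (@bounded_linear_continuous _ _ _ g); apply/linear_boundedP.
exists M; split=> [|r Mr x]; first exact: num_real.
by apply: le_trans (fM x) _; apply: ler_wpM2r => //; exact: ltW.
Qed.

Hypothesis f0 : forall x, 0 <=v x -> 0 <= f x.

Lemma posfun_homo x y : x <=v y -> f x <= f y.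
Proof. by move=> /rsubr_ge0/f0; rewrite linfunB// subr_ge0. Qed.

Lemma posfun_modulus x : `|f x| <= f (modulus x).
Proof.
rewrite ler_norml -[X in X <= _ <= _]linfunN//; apply/andP; split.
  rewrite -[x in _ <= f x]opprK !(linfunN lf) lerN2 -linfunN//.
  exact/posfun_homo/rleN_modulus.
exact/posfun_homo/rle_modulus.
Qed.

Lemma posfun_norm (M : R) : (forall x, 0 <=v x -> f x <= M * `|x|) ->
  forall x, `|f x| <= M * `|x|.
Proof.
move=> fM x; apply: le_trans (posfun_modulus x) _.
by rewrite -[`|x|]norm_modulus; apply/fM/modulus_ge0.
Qed.

End positive_functionals.

(** * A characterization of AL-spaces up to isomorphism *)

Section al_renorming.
Variables (R : realType) (E : banachLatticeType R).

(** Its value at the modulus is an equivalent norm that is additive on the cone. *)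
Record al_functional := ALFunctional {
  al_fun : E -> R;
  al_const : R;
  al_linear : linear (al_fun : E -> R^o);
  al_ge : forall x, 0 <=v x -> `|x| <= al_fun x;
  al_le : forall x, 0 <=v x -> al_fun x <= al_const * `|x|
}.

Variable psi : al_functional.

(* The dummy argument keys the new norm to the copy of [E]. *)
Definition al_renorm (_ : al_functional) : Type := E.

HB.instance Definition _ := Riesz.copy (al_renorm psi) E.

Definition al_norm (x : al_renorm psi) : R := al_fun psi (modulus (x : E)).

Lemma al_fun_homo x y : x <=v y -> al_fun psi x <= al_fun psi y.
Proof.
apply: (posfun_homo (al_linear psi)) => z /(al_ge psi); exact: le_trans.
Qed.

Lemma al_norm_ge x : `|x : E| <= al_norm x.
Proof. by rewrite -norm_modulus; apply/al_ge/modulus_ge0. Qed.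

Lemma al_norm_le x : al_norm x <= al_const psi * `|x : E|.
Proof. by rewrite -[`|_|]norm_modulus; apply/al_le/modulus_ge0. Qed.

Lemma al_normD x y : al_norm (x + y) <= al_norm x + al_norm y.
Proof. by rewrite /al_norm -(linfunD (al_linear psi)); apply/al_fun_homo/modulusD. Qed.

Lemma al_normZ (l : R) x : al_norm (l *: x) = `|l| * al_norm x.
Proof. by rewrite /al_norm modulusZ (linfunZ (al_linear psi)). Qed.

Lemma al_norm_eq0 x : al_norm x = 0 -> x = 0.
Proof.
move=> x0; apply/eqP; rewrite -(@normr_eq0 _ E) eq_le normr_ge0 andbT.
by rewrite -x0 al_norm_ge.
Qed.

HB.instance Definition _ := Lmodule_isNormed.Build R (al_renorm psi)
  al_normD al_normZ al_norm_eq0.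

Let F : normedModType R := al_renorm psi.

(** On the zero space [al_const] may be nonpositive; the maximum makes [K] a legitimate divisor. *)
Let K := Num.max 1 (al_const psi).
Let K0 : 0 < K.
Proof. by rewrite lt_max ltr01. Qed.

Lemma al_normE (x : F) : `|x| = al_norm x. Proof. by []. Qed.

Let al_ball (x y : E) (e : R) : ball x (e / K) y -> ball (x : F) e y.
Proof.
rewrite -!ball_normE /= ltr_pdivlMr// al_normE mulrC; apply: le_lt_trans.
apply: le_trans (al_norm_le _) _; apply: ler_wpM2r => //.
by rewrite le_max lexx orbT.
Qed.

Let al_complete (G : set_system F) : ProperFilter G -> cauchy G -> cvg G.
Proof.
move=> GG /cauchy_ballP Gc.
have /cauchy_cvg Gcvg : cauchy (G : set_system E).
  apply/cauchy_ballP => e e0; apply: filterS (Gc e e0) => -[x y] /=.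
  rewrite -!ball_normE /=; apply: le_lt_trans; exact: al_norm_ge.
apply/cvg_ex; exists (lim (G : set_system E) : F).
apply/cvg_ballP => e e0.
have /cvg_ballP/(_ (e / K)) := Gcvg; rewrite divr_gt0// => /(_ isT).
by apply: filterS => y; exact: al_ball.
Qed.

HB.instance Definition _ := Uniform_isComplete.Build (al_renorm psi) al_complete.

Let al_norm_modulus_le (x y : F) : modulus x <=v modulus y -> `|x| <= `|y|.
Proof. by move=> xy; exact: al_fun_homo. Qed.

HB.instance Definition _ := Riesz_CompleteNormedModule_isBanachLattice.Build
  R (al_renorm psi) al_norm_modulus_le.

(** The identity is the isomorphism, continuous both ways because the two norms bound each other. *)
Lemma al_renorm_iso : isomorphic_to_AL_space E.
Proof.
exists (al_renorm psi : banachLatticeType R); split.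
  move=> x y x0 y0; rewrite !al_normE /al_norm !modulus_id//.
    exact: linfunD (al_linear psi) x y.
  exact: raddr_ge0.
pose T : {linear E -> (al_renorm psi : banachLatticeType R)} := idfun.
pose S : {linear (al_renorm psi : banachLatticeType R) -> E} := idfun.
exists T, S; split=> //; split.
  apply: bounded_linear_continuous; apply/linear_boundedP.
  exists (al_const psi); split=> [|M KM x]; first exact: num_real.
  by apply: le_trans (al_norm_le _) _; apply: ler_wpM2r => //; exact: ltW.
apply: bounded_linear_continuous; apply/linear_boundedP.
exists 1; split=> [|M M1 x]; first exact: num_real.
apply: le_trans (al_norm_ge _) _; rewrite -al_normE.
by apply: ler_peMl => //; exact: ltW.
Qed.

End al_renorming.

(** * Disjoint positive families *)

Section disjoint_families.
Variables (R : realType) (E : banachLatticeType R).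
Implicit Types (x y : nat -> E) (v w z : E) (K C : R).

(** The vectors are arbitrary positive ones: a bound uniform in [n] is 1-concavity. *)
Definition lower_one_estimate n K := forall x, (forall i, 0 <=v x i) ->
  \sum_(i < n) `|x i| <= K * `|\sum_(i < n) x i|.

(** Each term is below the sum. This crude constant makes the set of admissible constants nonempty,
    so that its infimum can be taken. *)
Lemma lower_one_estimate_card n : lower_one_estimate n n%:R.
Proof.
move=> x x0; rewrite -[n in n%:R]card_ord -sumr_const mulr_suml.
apply: ler_sum => i _; rewrite mul1r; apply: norm_homo => //.
rewrite (bigD1 i)//=; apply: rleDl.
by apply: rsum_ge0 => j _.
Qed.

(* Hahn-Banach for the sublinear functional
   [P v = inf_(w >= 0) K |w| + \sum_i |(v_i - w)^+|]: any linear functional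
   below [P] has the first two bounds on its coordinates, and disjointness of
   [y] makes [P y] as large as possible. *)
Lemma disjoint_functionals n K y : 0 <= K -> lower_one_estimate n K ->
  (forall i, 0 <=v y i) -> (forall i k, (i < k)%N -> rdisj (y i) (y k)) ->
  exists psi : nat -> E -> R,
  [/\ forall i, linear (psi i : E -> R^o),
      forall i v, 0 <=v v -> 0 <= psi i v <= `|v|,
      forall v, 0 <=v v -> \sum_(i < n) psi i v <= K * `|v| &
      \sum_(i < n) `|y i| <= \sum_(i < n) psi i (y i)].
Proof.
move=> K0 Kn y0 yy.
pose A (v : nat -> E) :=
  [set K * `|w| + \sum_(i < n) `|rpos (v i - w)| | w in [set w : E | 0 <=v w]].
pose P (v : nat -> E) := inf (A v).
have Alb (v : nat -> E) : has_lbound (A v).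
  exists 0 => _ [w w0 <-]; apply: addr_ge0; first exact: mulr_ge0.
  exact: sumr_ge0.
have A0 (v : nat -> E) : A v !=set0.
  by exists (K * `|0 : E| + \sum_(i < n) `|rpos (v i - 0)|); exists 0 => //=; exact: rle_refl.
have P_le (v : nat -> E) w : 0 <=v w -> P v <= K * `|w| + \sum_(i < n) `|rpos (v i - w)|.
  by move=> w0; apply: ge_inf => //; exists w.
have P_le0 (v : nat -> E) : P v <= \sum_(i < n) `|rpos (v i)|.
  apply: le_trans (P_le v 0 (rle_refl _)) _.
  rewrite normr0 mulr0 add0r; apply: ler_sum => i _; by rewrite subr0.
have subP : sublinear P.
  split=> [u v|a v a0].
    apply: le_infD => // _ _ [w w0 <-] [w' w'0 <-].
    apply: le_trans (P_le _ (w + w') (raddr_ge0 w0 w'0)) _.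
    rewrite addrACA -mulrDr; apply: lerD.
      by apply: ler_wpM2l => //; exact: ler_normD.
    rewrite -big_split; apply: ler_sum => i _ /=.
    apply: le_trans (ler_normD _ _); apply: norm_homo; first exact: rpos_ge0.
    by rewrite -[(u + v) i]/(u i + v i) opprD addrACA; exact: rposD.
  rewrite -ler_pdivrMl//; apply: lb_le_inf => // _ [w w0 <-].
  rewrite ler_pdivrMl//.
  apply: le_trans (P_le _ (a *: w) (rle_scale_ge0 _ _ (ltW a0) w0)) _.
  rewrite normrZ mulrDr gtr0_norm// mulrCA lerD2l mulr_sumr.
  apply: ler_sum => i _; rewrite -[X in _ <= X * _](gtr0_norm a0) -normrZ.
  apply: norm_homo; first exact: rpos_ge0.
  by rewrite -[(a *: v) i]/(a *: v i) -scalerBr; apply/rposZ_le/ltW.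
have [f [lf fP fy]] := hahn_banach y subP.
pose e i v : nat -> E := fun l => if l == i then v else 0.
have eL i : linear (e i).
  by move=> a u v; apply/funext => l; rewrite /e /=;
    rewrite -[RHS]/(a *: (if l == i then u else 0) + (if l == i then v else 0));
    case: eqP => _ //; rewrite scaler0 addr0.
have sum_e (v : nat -> E) l : (l < n)%N -> (\sum_(i < n) e i (v i)) l = v l.
  move=> ln; rewrite fct_sumE (bigD1 (Ordinal ln))//= /e eqxx big1 ?addr0//.
  by move=> i /negPf; rewrite -val_eqE/= eq_sym => ->.
(* [P] sees only the first [n] coordinates, and [f <= P] passes this on to [f]; hence [f y] is the
   sum of its coordinate values. *)
have fext (u v : nat -> E) : (forall i, (i < n)%N -> u i = v i) -> f u = f v.
  move=> uv; have h (u' v' : nat -> E) : (forall i, (i < n)%N -> u' i = v' i) -> f u' <= f v'.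
    move=> uv'; rewrite -subr_ge0 -linfunB// -oppr_le0 -linfunN// opprB.
    apply: le_trans (fP _) _; apply: le_trans (P_le0 _) _.
    rewrite big1// => i _; rewrite -[(u' - v') i]/(u' i - v' i) uv'// subrr.
    by rewrite rpos_id ?normr0//; exact: rle_refl.
  by apply/eqP; rewrite eq_le !h// => i /uv.
have f_le i v : f (e i v) <= `|rpos v|.
  apply: le_trans (fP _) _; apply: le_trans (P_le0 _) _.
  have [ni|iN] := leqP n i.
    rewrite big1// => j _; rewrite /e ifN ?rpos_id ?normr0//; first exact: rle_refl.
    by rewrite neq_ltn (leq_trans (ltn_ord j)).
  rewrite (bigD1 (Ordinal iN))//= /e eqxx big1 ?addr0// => j.
  rewrite -val_eqE/= => /negPf ->; rewrite rpos_id ?normr0//; exact: rle_refl.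
exists (fun i v => f (e i v)); split.
- by move=> i a u v; rewrite eL lf.
- move=> i v v0; apply/andP; split; last first.
    by apply: le_trans (f_le _ _) _; exact: norm_rpos_le.
  have fel : linear ((fun w => f (e i w)) : E -> R^o).
    by move=> a u w; rewrite eL lf.
  (* Positivity: the bound at [- v] is the norm of [rpos (- v) = 0]. *)
  have := f_le i (- v); rewrite (linfunN fel v).
  suff -> : rpos (- v) = 0 by rewrite normr0 oppr_le0.
  by rewrite rposN rpos_id// subrr.
- move=> v v0; rewrite -linfun_sum//.
  apply: le_trans (fP _) _; apply: le_trans (P_le _ v v0) _.
  rewrite big1 ?addr0// => i _; rewrite (sum_e (fun=> v))// subrr.
  by rewrite rpos_id ?normr0//; exact: rle_refl.
- rewrite /= -(linfun_sum lf) (@fext _ y) ?fy; last by move=> i; exact: sum_e.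
  apply: lb_le_inf => // _ [w w0 <-].
  (* Disjointness enters here: the pieces [rmeet (y i) w] are disjoint and below [w], so their sum
     is below [w] too. *)
  have h : \sum_(i < n) `|rmeet (y i) w| <= K * `|w|.
    have := Kn (fun i => rmeet (y i) w) (fun i => rmeet_ge0 (y0 i) w0).
    move=> /le_trans; apply; apply: ler_wpM2l => //; apply: norm_homo.
      by apply: rsum_ge0 => i _; exact: rmeet_ge0.
    apply: (@rdisj_sum_le _ _ _ (fun i => rmeet (y i) w)) => //.
    + by move=> i; exact: rmeet_ge0.
    + by move=> i _; exact: rmeet_r.
    + by move=> i k /yy; apply: rdisj_le; exact: rmeet_l.
  apply: (@le_trans _ _ (\sum_(i < n) `|rmeet (y i) w| + \sum_(i < n) `|rpos (y i - w)|)).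
    rewrite -big_split /=; apply: ler_sum => i _.
    by apply: le_trans (ler_normD _ _); apply: norm_homo => //; exact: rle_meet_pos.
  by rewrite lerD2r.
Qed.

End disjoint_families.

(** Hahn-Banach for [q y], the infimum of [K |y + \sum z| - \sum |z|] over finite positive families;
    the estimate keeps it above [- K |y|]. The empty family gives [f x <= K |x|], and the family
    [[:: x]] at [- x] gives [f x >= |x|]. *)
Lemma al_functional_of_estimate (R : realType) (E : banachLatticeType R) (K : R) :
  0 <= K -> (forall n, lower_one_estimate E n K) -> inhabited (al_functional E).
Proof.
move=> K0 EK.
have {}EK (s : seq E) : (forall z, z \in s -> 0 <=v z) ->
    \sum_(z <- s) `|z| <= K * `|\sum_(z <- s) z|.
  move=> s0; have := EK (size s) (fun i => nth 0 s i).
  rewrite (big_nth 0) [\sum_(z <- s) z](big_nth 0) !big_mkord; apply => i.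
  have [si|si] := leqP (size s) i; first by rewrite nth_default//; exact: rle_refl.
  by apply: s0; exact: mem_nth.
pose pos := [set s : seq E | forall z, z \in s -> 0 <=v z].
pose A (y : E) := [set K * `|y + \sum_(z <- s) z| - \sum_(z <- s) `|z| | s in pos].
pose q y := inf (A y).
have pos0 : pos [::] by [].
have A0 y : A y !=set0.
  by exists (K * `|y + \sum_(z <- [::]) z| - \sum_(z <- ([::] : seq E)) `|z|); exists [::].
have Alb y : has_lbound (A y).
  exists (- (K * `|y|)) => _ [s /EK s0 <-].
  rewrite lerBrDr; apply: (le_trans (y := - (K * `|y|) + K * `|\sum_(z <- s) z|)).
    by rewrite lerD2l.
  rewrite -mulrN -mulrDr; apply: ler_wpM2l => //; rewrite addrC lerBlDr.
  by have := ler_normB (y + \sum_(z <- s) z) y; rewrite addrAC subrr add0r.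
have q_le y s : pos s -> q y <= K * `|y + \sum_(z <- s) z| - \sum_(z <- s) `|z|.
  by move=> s0; apply: ge_inf => //; exists s.
have subq : sublinear q.
  split=> [u v|a x a0].
    apply: le_infD => // _ _ [s s0 <-] [t t0 <-].
    have st0 : pos (s ++ t).
      by move=> z; rewrite mem_cat => /orP[/s0|/t0].
    apply: le_trans (q_le _ _ st0) _; rewrite !big_cat /= addrACA.
    have := ler_wpM2l K0 (ler_normD (u + \sum_(z <- s) z) (v + \sum_(z <- t) z)).
    lra.
  rewrite -ler_pdivrMl//; apply: lb_le_inf => // _ [s s0 <-].
  rewrite ler_pdivrMl//.
  have as0 : pos (map ( *:%R a) s).
    by move=> _ /mapP[z /s0 z0 ->]; apply: rle_scale_ge0 => //; exact: ltW.
  apply: le_trans (q_le _ _ as0) _; rewrite !big_map -scaler_sumr -scalerDr.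
  rewrite normrZ gtr0_norm// mulrBr mulrCA lerD2l lerN2 mulr_sumr.
  by apply: ler_sum => z _; rewrite normrZ gtr0_norm.
have [f [lf fq _]] := hahn_banach 0 subq.
constructor; apply: (@ALFunctional _ _ f K) => // x x0.
  have x0' : pos [:: x] by move=> z; rewrite inE => /eqP ->.
  have := le_trans (fq (- x)) (q_le _ _ x0').
  by rewrite !big_seq1 addNr normr0 mulr0 sub0r (linfunN lf) lerN2.
have := le_trans (fq x) (q_le _ _ pos0).
by rewrite !big_nil addr0 subr0.
Qed.

(** * From operators into l_2 to 1-concavity *)

Section estimate_from_operators.
Variables (R : realType) (E : banachLatticeType R).
Implicit Types (x y : nat -> E) (v w z : E) (K C : R).

(** The tuple [psi] is an operator from [E] to [l_2^n] of norm at most 1; the estimate bounds its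
    pairing with positive families. *)
Definition hilbertian_estimate C := forall n (psi : nat -> E -> R) x,
  (forall i, dual (psi i : E -> R^o)) -> (forall i, 0 <=v x i) ->
  (forall v, \sum_(i < n) psi i v ^+ 2 <= `|v| ^+ 2) ->
  \sum_(i < n) psi i (x i) <= C * `|\sum_(i < n) x i|.

(* [\sum_i psi_i v ^+ 2 <= K |v|^2] because each term of the sum is at most
   [|v| psi_i |v|]. *)
Lemma disjoint_estimate C n K y : hilbertian_estimate C ->
  1 <= K -> lower_one_estimate E n K ->
  (forall i, 0 <=v y i) -> (forall i k, (i < k)%N -> rdisj (y i) (y k)) ->
  \sum_(i < n) `|y i| <= C * Num.sqrt K * `|\sum_(i < n) y i|.
Proof.
move=> HC K1 EK y0 yy; have K0 : 0 < K by exact: lt_le_trans K1.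
have [psi [psil psi0 psiK psiy]] := disjoint_functionals (ltW K0) EK y0 yy.
have sK0 : 0 < Num.sqrt K by rewrite sqrtr_gt0.
pose phi i v := (Num.sqrt K)^-1 * psi i v.
have psin i v : `|psi i v| <= 1 * `|v|.
  apply: posfun_norm => // [w /psi0-/(_ i)/andP[]//|w /psi0-/(_ i)/andP[_]].
  by rewrite mul1r.
have phid i : dual (phi i : E -> R^o).
  apply: (@bounded_dual _ _ _ _ (Num.sqrt K)^-1) => [a u v|v].
    by rewrite /phi psil mulrDr mulrCA.
  rewrite normrM gtr0_norm ?invr_gt0//; apply: ler_wpM2l; first by rewrite invr_ge0 ltW.
  by have := psin i v; rewrite mul1r.
have phi2 v : \sum_(i < n) phi i v ^+ 2 <= `|v| ^+ 2.
  under eq_bigr do rewrite exprMn exprVn sqr_sqrtr ?(ltW K0)//.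
  rewrite -mulr_sumr ler_pdivrMl//.
  apply: (@le_trans _ _ (\sum_(i < n) `|v| * psi i (modulus v))).
    apply: ler_sum => i _; rewrite -real_normK ?num_real// expr2.
    apply: ler_pM => //; first by have := psin i v; rewrite mul1r.
    by apply: posfun_modulus => // w /psi0-/(_ i)/andP[].
  rewrite -mulr_sumr expr2 mulrCA; apply: ler_wpM2l => //.
  by rewrite -[X in K * X]norm_modulus; apply/psiK/modulus_ge0.
have := HC n phi y phid y0 phi2.
rewrite /phi -mulr_sumr ler_pdivrMl// => h.
apply: le_trans psiy _; apply: le_trans h _; by rewrite mulrA [_ * C]mulrC.
Qed.

(* With [s_i] the partial sums of [x], the piece [y j i] is what remains of
   the cell of height [z0] above the level [j.+1 *: z0] when that level is cut
   out of the slice between [s_i] and [s_i.+1]: a given level meets at most one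
   slice at each point, and averaging over the levels recovers [x]. *)
Lemma disjointification m n x : (0 < m)%N -> (forall i, 0 <=v x i) ->
  let z0 := m%:R^-1 *: \sum_(i < n) x i in
  exists y : nat -> nat -> E,
  [/\ forall j i, 0 <=v y j i,
      forall j i k, (i < k)%N -> rdisj (y j i) (y j k),
      forall j, \sum_(i < n) y j i <=v z0 &
      forall i, (i < n)%N -> x i <=v \sum_(j < m) y j i + z0].
Proof.
move=> m0 x0 z0; pose s k := \sum_(i < k) x i.
have s0 k : 0 <=v s k by apply: rsum_ge0.
have sS k : s k.+1 = s k + x k by rewrite /s big_ord_recr.
have s_homo i k : (i <= k)%N -> s i <=v s k.
  elim: k => [|k IH]; first by rewrite leqn0 => /eqP ->; exact: rle_refl.
  rewrite leq_eqVlt => /predU1P[->|]; first exact: rle_refl.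
  by rewrite ltnS => /IH/rle_trans; apply; rewrite sS; exact: rleDl.
have z00 : 0 <=v z0 by apply: rle_scale_ge0 => //; exact: s0.
pose t j : E := z0 *+ j.
have tS j : t j.+1 = t j + z0 by rewrite /t mulrSr.
have tm : t m = s n.
  by rewrite /t -scaler_nat /z0 scalerA mulfV ?scale1r// pnatr_eq0 -lt0n.
have t0 j : 0 <=v t j.
  elim: j => [|j IH]; first exact: rle_refl.
  by rewrite tS; exact: raddr_ge0.
pose y j i := rmeet (rmeet (rpos (s i.+1 - t j.+1)) (rpos (t j.+1 - s i))) z0.
have y0 j i : 0 <=v y j i.
  by apply: rmeet_ge0 => //; apply: rmeet_ge0; exact: rpos_ge0.
have yd j i k : (i < k)%N -> rdisj (y j i) (y j k).
  (* As [s i.+1 <=v s k], the two cells lie below the positive and the negative part of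
     [s i.+1 - t j.+1]. *)
  move=> ik; apply: (@rdisj_le _ _ (rpos (s i.+1 - t j.+1)) (rpos (- (s i.+1 - t j.+1)))).
  - exact: rle_trans (rmeet_l _ _) (rmeet_l _ _).
  - apply: rle_trans (rmeet_l _ _) _; apply: rle_trans (rmeet_r _ _) _.
    apply: rpos_homo; rewrite opprB; apply: rleD; first exact: rle_refl.
    exact/rleN/s_homo.
  - exact: rdisj_pos.
exists y; split=> //.
- move=> j; apply: (rdisj_sum_le z00 (y0 j)); last exact: yd.
  by move=> i _; exact: rmeet_r.
move=> i ni.
(* The increment of [s i.+1] between the levels [t j.+1] and [t j.+2], less that of [s i] one level
   lower. The shift makes [D j] fit below [y j i] and costs the extra [z0] after telescoping. *)
pose D j := (rmeet (s i.+1) (t j.+2) - rmeet (s i.+1) (t j.+1)) -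
            (rmeet (t j.+1) (s i) - rmeet (t j) (s i)).
have Dy j : D j <=v y j i.
  have A0 : 0 <=v rmeet (t j.+1) (s i) - rmeet (t j) (s i).
    apply/rsubr_ge0/le_rmeet; split; last exact: rmeet_r.
    by apply: rle_trans (rmeet_l _ _) _; rewrite tS; exact: rleDl.
  have B1 : rmeet (s i.+1) (t j.+2) - rmeet (s i.+1) (t j.+1) <=v
      rpos (s i.+1 - t j.+1).
    apply/rle_subLR; apply: rle_trans (rmeet_l _ _) _; exact: rle_meet_pos.
  have Bz : rmeet (s i.+1) (t j.+2) - rmeet (s i.+1) (t j.+1) <=v z0.
    apply/rle_subLR; rewrite addrC; apply/rle_subLR/le_rmeet; split.
      apply/rle_subLR; apply: rle_trans (rmeet_l _ _) _.
      by rewrite addrC; exact: rleDl.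
    apply/rle_subLR; apply: rle_trans (rmeet_r _ _) _.
    by rewrite tS addrC; exact: rle_refl.
  have BA u : rmeet (s i.+1) (t j.+2) - rmeet (s i.+1) (t j.+1) <=v u -> D j <=v u.
    move=> Bu; apply/rle_subLR; apply: rle_trans Bu _.
    by rewrite addrC; exact: rleDl.
  apply/le_rmeet; split; last exact: BA.
  apply/le_rmeet; split; first exact: BA.
  (* Against [rpos (t j.+1 - s i)]: [z0] added to [rmeet (t j) (s i)] stays below [t j.+1], which
     [rle_meet_pos] splits at [s i]. *)
  apply/rle_subLR; apply: rle_trans Bz _.
  rewrite addrAC; apply/rsubr_ge0.
  have -> : rmeet (t j.+1) (s i) + rpos (t j.+1 - s i) - rmeet (t j) (s i) - z0 =
    (rmeet (t j.+1) (s i) + rpos (t j.+1 - s i)) - (rmeet (t j) (s i) + z0).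
    by rewrite opprD addrA.
  apply/rsubr_ge0; apply: rle_trans (rle_meet_pos _ (s i)).
  by rewrite tS; apply: rleD2r; exact: rmeet_l.
have sumD k : \sum_(j < k) D j = rmeet (s i.+1) (t k.+1) - rmeet (s i.+1) (t 1) -
    (rmeet (t k) (s i) - rmeet (t 0) (s i)).
  rewrite /D sumrB; congr (_ - _).
    by rewrite -(telescope_sumr (fun j => rmeet (s i.+1) (t j.+1)))// big_mkord.
  by rewrite -(telescope_sumr (fun j => rmeet (t j) (s i)))// big_mkord.
apply: (@rle_trans _ _ (\sum_(j < m) D j + z0)); last first.
  by apply: rleD2r; apply: rle_sum => j _; exact: Dy.
(* As [s i.+1 <=v s n = t m], the telescoped sum is [x i - r] with [r] at most [t 1 = z0]. *)
rewrite sumD (@rmeet_lel _ _ _ (t m.+1)); last first.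
  apply: rle_trans (s_homo _ n _) _ => //.
  by rewrite tS tm; exact: rleDl.
rewrite (@rmeet_ler _ _ (t m)); last by rewrite tm; apply/s_homo/ltnW.
rewrite (@rmeet_lel _ _ (t 0)); last exact: s0.
rewrite {2}/t mulr0n subr0 sS; set r := rmeet _ (t 1).
have -> : s i + x i - r - s i + z0 = x i + (z0 - r).
  rewrite [s i + x i]addrC -!addrA; congr (_ + _).
  by rewrite addrCA [s i + _]addrA subrr add0r addrC.
by apply/rleDl/rsubr_ge0; exact: rmeet_r.
Qed.

(** Disjointification carries the disjoint bound over to all positive families: each of the [m]
    levels contributes [C sqrt K |z| / m], and the error [n |z| / m] vanishes as [m] grows. *)
Lemma estimate_improve C n K : 0 <= C -> hilbertian_estimate C ->
  1 <= K -> lower_one_estimate E n K ->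
  lower_one_estimate E n (C * Num.sqrt K).
Proof.
move=> C0 HC K1 EK x x0; set z := \sum_(i < n) x i.
have h m : (0 < m)%N ->
    \sum_(i < n) `|x i| <= C * Num.sqrt K * `|z| + n%:R * `|z| / m%:R.
  move=> m0; have [y [y0 yd yz xy]] := disjointification n m0 x0.
  have mR0 : (0 : R) < m%:R by rewrite ltr0n.
  have nz0 : `|m%:R^-1 *: z| = m%:R^-1 * `|z|.
    by rewrite normrZ gtr0_norm// invr_gt0.
  apply: (@le_trans _ _ (\sum_(i < n) (\sum_(j < m) `|y j i| + m%:R^-1 * `|z|))).
    apply: ler_sum => i _; rewrite -nz0.
    apply: (@le_trans _ _ `|\sum_(j < m) y j i + m%:R^-1 *: z|).
      by apply: norm_homo => //; exact: xy.
    by apply: le_trans (ler_normD _ _) _; rewrite lerD2r; exact: ler_norm_sum.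
  rewrite big_split /= sumr_const card_ord; apply: lerD; last first.
    by rewrite -[X in X <= _]mulr_natl [m%:R^-1 * _]mulrC mulrA.
  rewrite exchange_big /=.
  apply: (@le_trans _ _ (\sum_(j < m) C * Num.sqrt K * (m%:R^-1 * `|z|))).
    apply: ler_sum => j _.
    apply: le_trans (disjoint_estimate HC K1 EK (y0 j) (yd j)) _.
    apply: ler_wpM2l; first by rewrite mulr_ge0// sqrtr_ge0.
    rewrite -nz0; apply: norm_homo (yz j).
    by apply: rsum_ge0.
  by rewrite sumr_const card_ord -[X in X <= _]mulr_natl mulrCA mulVKf// gt_eqF.
apply/ler_addgt0Pr => e e0; set B := n%:R * `|z|.
have B0 : 0 <= B by exact: mulr_ge0.
have /archi_boundP Be : 0 <= B / e by rewrite divr_ge0// ltW.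
have m0 : (0 < Num.bound (B / e))%N.
  by rewrite -(ltr0n R); apply: le_lt_trans Be; rewrite divr_ge0// ltW.
apply: le_trans (h _ m0) _; rewrite lerD2l ler_pdivrMr ?ltr0n//.
by rewrite [e * _]mulrC -ler_pdivrMr//; exact: ltW.
Qed.

(** The least constant [K >= 1] satisfies [K <= C sqrt K], hence [K <= C^2], whatever [n] is. *)
Lemma lower_one_estimate_sqr C n : 1 <= C -> hilbertian_estimate C ->
  lower_one_estimate E n (C ^+ 2).
Proof.
move=> C1 HC; pose S := [set K | 1 <= K /\ lower_one_estimate E n K].
(* The successor ensures [1 <= K] also for [n = 0]. *)
have S0 : S n.+1%:R.
  split; first by rewrite ler1n.
  move=> x x0; apply: le_trans (@lower_one_estimate_card _ _ n x x0) _.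
  by apply: ler_wpM2r => //; rewrite ler_nat.
have Sne : S !=set0 by exists n.+1%:R.
have Slb : has_lbound S by exists 1 => K [].
have K1 : 1 <= inf S by apply: lb_le_inf => // K [].
have EK : lower_one_estimate E n (inf S).
  move=> x x0; have [z0|z0] := eqVneq (\sum_(i < n) x i) 0.
    by have [_ /(_ x x0)] := S0; rewrite z0 normr0 !mulr0.
  rewrite -ler_pdivrMr ?normr_gt0//; apply: lb_le_inf => // K [_ EK].
  by rewrite ler_pdivrMr ?normr_gt0//; exact: EK.
have infS : inf S <= C * Num.sqrt (inf S).
  apply: ge_inf => //; split.
    by rewrite -[1]mulr1; apply: ler_pM => //; rewrite -sqrtr1 ler_wsqrtr.
  by apply: estimate_improve => //; exact: le_trans C1.
have infS0 : 0 < inf S by exact: lt_le_trans K1.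
have sC : Num.sqrt (inf S) <= C.
  have sS0 : 0 < Num.sqrt (inf S) by rewrite sqrtr_gt0.
  by rewrite -(ler_pM2r sS0) -expr2 sqr_sqrtr// ltW.
move=> x x0; apply: le_trans (EK x x0) _; apply: ler_wpM2r => //.
rewrite -[X in X <= _](sqr_sqrtr (ltW infS0)).
by apply: lerXn2r; rewrite ?nnegrE ?sqrtr_ge0//; exact: le_trans C1.
Qed.
Theorem isomorphic_to_AL_of_hilbertian_estimate C :
  hilbertian_estimate C -> isomorphic_to_AL_space E.
Proof.
move=> HC; have H1 : hilbertian_estimate (Num.max 1 C).
  move=> n psi x d x0 h; apply: le_trans (HC n psi x d x0 h) _.
  by apply: ler_wpM2r => //; rewrite le_max lexx orbT.
have [|psi] := @al_functional_of_estimate _ E (Num.max 1 C ^+ 2) (sqr_ge0 _).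
  by move=> n; apply: lower_one_estimate_sqr => //; rewrite le_max lexx.
exact: al_renorm_iso psi.
Qed.

End estimate_from_operators.

(** * Rademacher sums *)

Section rademacher.
Variables (R : realType) (n : nat).
Implicit Types (a : 'I_n -> R) (q M : R).

Local Notation signs := {ffun 'I_n -> bool}.

Definition sgnb (b : bool) : R := if b then 1 else -1.

Definition rademacher a (e : signs) : R := \sum_(i < n) sgnb (e i) * a i.

Lemma card_signs : #|{: signs}| = (2 ^ n)%N.
Proof. by rewrite card_ffun card_bool card_ord. Qed.

Lemma expR_le_inv (x : R) : x < 1 -> expR x <= (1 - x)^-1.
Proof.
move=> x1; rewrite -[x in expR x]opprK expRN lef_pV2 ?posrE ?expR_gt0 ?subr_gt0//.
by have := expR_ge1Dx (- x).
Qed.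

(** [e^x + e^-x <= 1/(1-x) + 1/(1+x) = 2/(1-x^2) <= 2 (1 + 2 x^2)], the last inequality by
    [x^2 <= 1/2]. *)
Lemma cosh_le (x : R) : x ^+ 2 <= 2^-1 -> expR x + expR (- x) <= 2 * expR (2 * x ^+ 2).
Proof.
move=> x2; have x1 : -1 < x < 1 by apply/andP; split; nra.
have [h1 h2] := andP x1.
have hp : (0 : R) < 1 - x by lra.
have hm : (0 : R) < 1 + x by lra.
have hN : - x < 1 by lra.
have e1 := expR_le_inv h2.
have e2 := expR_le_inv hN.
have e3 := expR_ge1Dx (2 * x ^+ 2).
rewrite opprK in e2.
apply: le_trans (lerD e1 e2) _.
apply: le_trans (ler_wpM2l _ e3) => //.
have -> : (1 - x)^-1 + (1 + x)^-1 = 2 / ((1 - x) * (1 + x)).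
  by field; rewrite !gt_eqF.
rewrite ler_pdivrMr ?mulr_gt0//; nra.
Qed.

(** Independence of the signs: the sum of products is the product of two-term sums, each bounded by
    [cosh_le]. *)
Lemma rademacher_expR a : (forall i, a i ^+ 2 <= 2^-1) ->
  \sum_(e : signs) expR (rademacher a e) <=
  (2 ^ n)%:R * expR (2 * \sum_(i < n) a i ^+ 2).
Proof.
move=> a2; under eq_bigr do rewrite expR_sum.
rewrite -(bigA_distr_bigA (fun i b => expR (sgnb b * a i))) /=.
apply: (@le_trans _ _ (\prod_(i < n) (2 * expR (2 * a i ^+ 2)))).
  apply: ler_prod => i _; rewrite big_bool /= mul1r mulN1r.
  by rewrite addr_ge0 ?expR_ge0//= cosh_le.
by rewrite big_split /= prodr_const card_ord natrX mulr_sumr expR_sum.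
Qed.

(** Raise [|t| <= q e^(|t|/q)] to the power [q] and bound [e^|t|] by [e^t + e^-t]. *)
Lemma powR_le_expR q (t : R) : 0 < q ->
  `|t| `^ q <= q `^ q * (expR t + expR (- t)).
Proof.
move=> q0.
have h : `|t| <= q * expR (`|t| / q).
  rewrite -ler_pdivrMl// mulrC; apply: le_trans (expR_ge1Dx _).
  by rewrite lerDr.
apply: (@le_trans _ _ ((q * expR (`|t| / q)) `^ q)).
  by apply: ge0_ler_powR; rewrite ?nnegrE ?mulr_ge0 ?expR_ge0 ?(ltW q0).
rewrite powRM ?(ltW q0) ?expR_ge0//; apply: ler_wpM2l; first exact: powR_ge0.
rewrite /powR gt_eqF ?expR_gt0// expRK mulrC divfK ?gt_eqF//.
by case: (ger0P t) => _; rewrite ?lerDl ?lerDr expR_ge0.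
Qed.

(* From [|t|^q <= q^q (e^t + e^-t)] and [e^t + e^-t <= 2 e^(2 t^2)], after
   dividing [a] by [2 M]. *)
Definition khintchine_const q : R := 2 `^ q * (q `^ q * (2 * expR 1)).

Lemma khintchine_const_gt0 q : 0 < q -> 0 < khintchine_const q.
Proof.
by move=> q0; rewrite /khintchine_const !mulr_gt0 ?powR_gt0 ?expR_gt0.
Qed.

Lemma rademacherZ (c : R) a e :
  rademacher (fun i => c * a i) e = c * rademacher a e.
Proof. by rewrite /rademacher mulr_sumr; apply: eq_bigr => i _; rewrite mulrCA. Qed.

Lemma khintchine q a M : 0 < q -> 0 <= M -> \sum_(i < n) a i ^+ 2 <= M ^+ 2 ->
  \sum_(e : signs) `|rademacher a e| `^ q <=
  khintchine_const q * (2 ^ n)%:R * M `^ q.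
Proof.
move=> q0 M0 aM; have a_le b i : b i ^+ 2 <= \sum_(i < n) (b i : R) ^+ 2.
  by rewrite (bigD1 i)//= lerDl sumr_ge0// => j _; exact: sqr_ge0.
(* Under this normalization the exponent [2 \sum b_i^2] is at most 1, whence the factor [expR 1];
   the two exponentials belong to [b] and [- b]. *)
have key b : \sum_(i < n) b i ^+ 2 <= 2^-1 ->
    \sum_(e : signs) `|rademacher b e| `^ q <= (2 ^ n)%:R * (q `^ q * (2 * expR 1)).
  move=> b2; have bi i : b i ^+ 2 <= 2^-1 by exact: le_trans (a_le b i) b2.
  have half c : (forall i, c i ^+ 2 = b i ^+ 2) ->
      \sum_(e : signs) expR (rademacher c e) <= (2 ^ n)%:R * expR 1.
    move=> cb; apply: le_trans (rademacher_expR _) _ => [i|]; first by rewrite cb.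
    apply: ler_wpM2l => //; rewrite ler_expR; under eq_bigr do rewrite cb.
    by rewrite -ler_pdivlMl// mulr1.
  apply: (@le_trans _ _ (\sum_(e : signs) q `^ q *
      (expR (rademacher b e) + expR (rademacher (fun i => -1 * b i) e)))).
    apply: ler_sum => e _; rewrite rademacherZ mulN1r; exact: powR_le_expR.
  rewrite -mulr_sumr mulrCA; apply: ler_wpM2l; first exact: powR_ge0.
  rewrite big_split /= mulrCA mulr_natl mulr2n; apply: lerD; apply: half => // i.
  by rewrite mulN1r sqrrN.
(* [M = 0] forces all coefficients to vanish; otherwise one can divide by [2 M]. *)
move: M0; rewrite le_eqVlt => /predU1P[M0|M0].
  rewrite big1 => [|e _]; first by rewrite !mulr_ge0 ?powR_ge0 ?(ltW (khintchine_const_gt0 q0)).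
  suff -> : rademacher a e = 0 by rewrite normr0 powR0// gt_eqF.
  rewrite /rademacher big1// => i _; apply/eqP; rewrite mulf_eq0; apply/orP; right.
  rewrite -sqrf_eq0 eq_le sqr_ge0 andbT.
  by apply: le_trans (a_le a i) _; apply: le_trans aM _; rewrite -M0 expr0n.
have M2 : 0 < 2 * M by rewrite mulr_gt0.
have := key (fun i => (2 * M)^-1 * a i).
have -> : \sum_(i < n) ((2 * M)^-1 * a i) ^+ 2 <= 2^-1.
  under eq_bigr do rewrite exprMn.
  rewrite -mulr_sumr; apply: le_trans (ler_wpM2l _ aM) _; first exact: sqr_ge0.
  by rewrite -exprMn invfM -mulrA mulVf ?gt_eqF// mulr1; lra.
move=> /(_ isT) h.
have -> : \sum_(e : signs) `|rademacher a e| `^ q =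
    (2 * M) `^ q * \sum_(e : signs) `|rademacher (fun i => (2 * M)^-1 * a i) e| `^ q.
  rewrite mulr_sumr; apply: eq_bigr => e _.
  rewrite rademacherZ normrM -powRM ?(ltW M2)//.
  by rewrite gtr0_norm ?invr_gt0// mulVKf// gt_eqF.
apply: le_trans (ler_wpM2l (powR_ge0 _ _) h) _.
rewrite powRM ?(ltW M0)// /khintchine_const le_eqVlt; apply/orP; left; apply/eqP; ring.
Qed.

Definition flip (i : 'I_n) (e : signs) : signs :=
  [ffun k => if k == i then ~~ e k else e k].

Lemma flipK i : involutive (flip i).
Proof. by move=> e; apply/ffunP => k; rewrite !ffunE; case: eqP => // _; rewrite negbK. Qed.

(** Pair [e] with [flip i e]. For [i <> k] the two terms cancel; for [i = k] exactly one of them is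
    1 and the other 0. *)
Lemma sum_sgnb (i k : 'I_n) :
  \sum_(e : signs) sgnb (e i) * (e k)%:R = (if i == k then 2^-1 else 0) * (2 ^ n)%:R.
Proof.
set S := LHS; suff : S + S = (if i == k then 1 else 0) * (2 ^ n)%:R.
  by case: eqP => _; lra.
rewrite {2}/S (reindex_inj (inv_inj (flipK i))) /= -big_split /=.
case: eqVneq => [<-|ik].
  rewrite mul1r -card_signs -sum1_card natr_sum; apply: eq_bigr => e _.
  by rewrite ffunE eqxx; case: (e i) => /=; rewrite /sgnb /= ?mulr0 ?addr0 ?add0r ?mul1r.
rewrite mul0r big1// => e _.
rewrite !ffunE eqxx [k == i]eq_sym (negPf ik).
by case: (e i); rewrite /sgnb /=; ring.
Qed.

End rademacher.


(** * Blocks built from Rademacher sums *)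

Section rademacher_blocks.
Variables (R : realType) (E : banachLatticeType R) (p q : R).
Hypotheses (q0 : 0 < q) (pq : p^-1 + q^-1 = 1).

(* [g] has norm at most 1 as an operator into [l_q], and [u] is below the
   constant sequence [N^(-1/p) z], of norm at most 1 in [l_p^pi(E)]. *)
Definition rademacher_block (C : R) :=
  exists N (g : nat -> E -> R) (u : nat -> E) (z : E),
  [/\ (0 < N)%N, `|z| <= 1 & forall l, dual (g l : E -> R^o)] /\
  [/\ forall v, \sum_(l < N) `|g l v| `^ q <= `|v| `^ q,
      forall l, 0 <=v u l,
      forall l, u l <=v N%:R `^ (- p^-1) *: z &
      C <= \sum_(l < N) g l (u l)].

(** Khintchine's inequality bounds the operator, and by [sum_sgnb] only the diagonal terms
    [psi i (x i)] survive in the pairing, each with weight [2^n / 2]. The normalizations [2^(-n/q)]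
    and [2^(-n/p)] cancel [2^n] since [1/p + 1/q = 1]. *)
Lemma exists_rademacher_block n (psi : nat -> E -> R) (x : nat -> E) :
  (forall i, dual (psi i : E -> R^o)) -> (forall i, 0 <=v x i) ->
  (forall v, \sum_(i < n) psi i v ^+ 2 <= `|v| ^+ 2) ->
  `|\sum_(i < n) x i| <= 1 ->
  rademacher_block (khintchine_const q `^ (- q^-1) / 2 * \sum_(i < n) psi i (x i)).
Proof.
move=> psid x0 psi2 z1; pose T : finType := {ffun 'I_n -> bool}.
have TN : #|T| = (2 ^ n)%N by exact: card_signs.
have N0 : (0 : R) < (2 ^ n)%:R by rewrite ltr0n expn_gt0.
have k0 := khintchine_const_gt0 q0.
pose S (e : T) v := rademacher (fun i : 'I_n => psi i v) e.
pose al : R := (khintchine_const q * (2 ^ n)%:R) `^ (- q^-1).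
pose g (e : T) v := al * S e v.
pose u (e : T) := (2 ^ n)%:R `^ (- p^-1) *: \sum_(i < n | e i) x i.
(* A default value for [nth] in the list of sign vectors. *)
pose e0 : T := [ffun=> true].
have sumT (F : T -> R) : \sum_(l < #|T|) F (nth e0 (enum T) l) = \sum_e F e.
  by rewrite -[RHS]big_enum (big_nth e0) big_mkord -cardE.
have gB e v : `|g e v| `^ q = (khintchine_const q * (2 ^ n)%:R)^-1 * `|S e v| `^ q.
  have al0 : 0 <= al by exact: powR_ge0.
  rewrite normrM (ger0_norm al0) powRM// /al -powRrM.
  by rewrite mulNr mulVf ?gt_eqF// powR_inv1// mulr_ge0// ltW.
have gq v : \sum_e `|g e v| `^ q <= `|v| `^ q.
  under eq_bigr do rewrite gB.
  by rewrite -mulr_sumr (ler_pdivrMl _ _ (mulr_gt0 k0 N0)); apply: khintchine.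
have Sl e : linear (S e : E -> R^o).
  move=> a s t; rewrite /S /rademacher scaler_sumr -big_split /=.
  apply: eq_bigr => i _; have [li _] := psid i.
  by rewrite (li a s t) mulrDr; congr (_ + _); rewrite -[LHS]/(_ * (a * _)) mulrCA.
have gl e : linear (g e : E -> R^o).
  by move=> a s t; rewrite /g Sl mulrDr; congr (_ + _); rewrite -[LHS]/(_ * (a * _)) mulrCA.
have gd e : dual (g e : E -> R^o).
  apply: (@bounded_dual _ _ _ (gl e) 1) => t; rewrite mul1r.
  rewrite -[`|g e t|]powRr1// -[`|t|]powRr1// -(mulfV (lt0r_neq0 q0)) !powRrM.
  apply: ge0_ler_powR; rewrite ?nnegrE ?powR_ge0 ?invr_ge0 ?(ltW q0)//.
  apply: le_trans (gq t); rewrite (bigD1 e)//= lerDl; apply: sumr_ge0 => e1 _.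
  exact: powR_ge0.
have xe0 (P : pred 'I_n) : 0 <=v \sum_(i < n | P i) x i by apply: rsum_ge0.
have uz e : u e <=v (2 ^ n)%:R `^ (- p^-1) *: \sum_(i < n) x i.
  apply: rle_scale; first exact: powR_ge0.
  by rewrite [in X in _ <=v X](bigID (fun i : 'I_n => e i)) /=; apply: rleDl.
exists #|T|, (fun l => g (nth e0 (enum T) l)), (fun l => u (nth e0 (enum T) l)), (\sum_(i < n) x i).
split; first by split=> //; rewrite TN expn_gt0.
split.
- by move=> v; rewrite (sumT (fun e => `|g e v| `^ q)).
- by move=> l; apply: rle_scale_ge0 => //; exact: powR_ge0.
- by move=> l; rewrite TN.
rewrite (sumT (fun e => g e (u e))).
rewrite le_eqVlt; apply/orP; left; rewrite eq_sym; apply/eqP.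
have gu e : g e (u e) = al * (2 ^ n)%:R `^ (- p^-1) *
    \sum_(i < n) \sum_(k < n) psi i (x k) * (sgnb R (e i) * (e k)%:R).
  rewrite /u (linfunZ (gl e)) /g mulrCA mulrA; congr (_ * _).
  rewrite /S /rademacher; apply: eq_bigr => i _.
  have [li _] := psid i.
  rewrite (linfun_sum li) big_mkcond /= mulr_sumr; apply: eq_bigr => k _.
  by case: (e k); rewrite ?mulr1 ?mulr0// mulrC.
under eq_bigr do rewrite gu.
rewrite -mulr_sumr exchange_big /=.
have -> : \sum_(i < n) \sum_e \sum_(k < n) psi i (x k) * (sgnb R ((e : T) i) * (e k)%:R) =
   \sum_(i < n) psi i (x i) * (2^-1 * (2 ^ n)%:R).
  apply: eq_bigr => i _; rewrite exchange_big /= (bigD1 i)//=.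
  rewrite -mulr_sumr sum_sgnb eqxx big1 ?addr0// => k ki.
  by rewrite -mulr_sumr sum_sgnb eq_sym (negPf ki) mul0r mulr0.
rewrite -mulr_suml /al powRM ?(ltW k0) ?(ltW N0)//.
have -> : (2 ^ n)%:R `^ (- p^-1) = (2 ^ n)%:R^-1 * (2 ^ n)%:R `^ (q^-1) :> R.
  rewrite -(powR_inv1 (ltW N0)) -powRD; last by apply/implyP => _; rewrite gt_eqF.
  by congr (_ `^ _); rewrite -pq; ring.
rewrite (powRN (2 ^ n)%:R).
have Nq : (2 ^ n)%:R `^ (q^-1) != 0 :> R by rewrite gt_eqF// powR_gt0.
have Nn : (2 ^ n)%:R != 0 :> R by rewrite gt_eqF.
field.
by rewrite Nq Nn.
Qed.

(** If no block reached [C], [exists_rademacher_block] for [x] divided by the norm of its sum would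
    give the hilbertian estimate with constant [C / c], where [c] is the factor lost there. *)
Lemma rademacher_block_of_not_AL : ~ isomorphic_to_AL_space E ->
  forall C, rademacher_block C.
Proof.
move=> nAL C; have k0 := khintchine_const_gt0 q0.
pose c := khintchine_const q `^ (- q^-1) / 2.
have c0 : 0 < c by rewrite divr_gt0// powR_gt0.
apply: contrapT => nb; apply/nAL/(@isomorphic_to_AL_of_hilbertian_estimate _ _ (C / c)).
move=> n psi x psid x0 psi2; rewrite leNgt; apply/negP => h; apply: nb.
set z := \sum_(i < n) x i in h.
have [z0|z0] := eqVneq z 0.
  exfalso; move: h; rewrite z0 normr0 mulr0 big1 ?ltxx// => i _.
  suff -> : x i = 0 by have [li _] := psid i; exact: linfun0 li.
  apply: rle_anti => //; rewrite -z0 /z (bigD1 i)//=.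
  by apply: rleDl; apply: rsum_ge0.
have nz : 0 < `|z| by rewrite normr_gt0.
have [||N [g [u [w [h1 [h2 h3 h4 h5]]]]]] :=
    @exists_rademacher_block n psi (fun i => `|z|^-1 *: x i) psid _ psi2.
- by move=> i; apply: rle_scale_ge0 => //; rewrite invr_ge0.
- by rewrite -scaler_sumr normrZ gtr0_norm ?invr_gt0// mulVf ?gt_eqF.
exists N, g, u, w; split=> //; split=> //.
apply: le_trans h5; rewrite -/c -ler_pdivrMl//.
under eq_bigr => i _.
  have [li _] := psid i; rewrite (linfunZ li).
  over.
rewrite /= -mulr_sumr ler_pdivlMl// [`|z| * _]mulrC [c^-1 * _]mulrC.
exact: ltW.
Qed.

End rademacher_blocks.

(** * Summability *)

Section finite_sums.
Context {R : realType}.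

(** Unordered summability of nonnegative families, over any index type and invariant under
    reindexing. *)
Definition fsummable (T : eqType) (a : T -> R) :=
  exists M : R, forall s : seq T, uniq s -> \sum_(t <- s) a t <= M.

Lemma ler_sum_uniq (T : eqType) (a : T -> R) (r s : seq T) :
  (forall t, 0 <= a t) -> uniq r -> uniq s -> {subset r <= s} ->
  \sum_(t <- r) a t <= \sum_(t <- s) a t.
Proof.
move=> a0 ur us rs; rewrite [leRHS](bigID [in r]) /= -[X in _ <= X + _]big_filter.
have sr : perm_eq [seq t <- s | t \in r] r.
  apply: uniq_perm => //; first exact: filter_uniq.
  by move=> t; rewrite mem_filter; case: (boolP (t \in r)) => //= /rs.
by rewrite (perm_big _ sr) lerDl; apply: sumr_ge0 => t _.
Qed.

Lemma fsummable_le (T : eqType) (a b : T -> R) (c : R) : 0 <= c ->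
  (forall t, a t <= c * b t) -> fsummable b -> fsummable a.
Proof.
move=> c0 ab [M bM]; exists (c * M) => s us.
apply: le_trans (ler_wpM2l c0 (bM s us)); rewrite mulr_sumr.
exact: ler_sum.
Qed.

Lemma fsummableD (T : eqType) (a b : T -> R) :
  fsummable a -> fsummable b -> fsummable (fun t => a t + b t).
Proof.
move=> [M aM] [M' bM']; exists (M + M') => s us.
by rewrite big_split lerD ?aM ?bM'.
Qed.

Lemma fsummable_inj (T U : eqType) (h : U -> T) (a : T -> R) :
  injective h -> fsummable a -> fsummable (a \o h).
Proof.
move=> hI [M aM]; exists M => s us.
by have := aM (map h s); rewrite big_map map_inj_uniq//; exact.
Qed.

(** The map [h] reaches every index with [a t != 0]; a list of such indices is the image under [h]
    of its image under [g], which is again duplicate-free. *)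
Lemma fsummable_supp (T U : eqType) (h : U -> T) (g : T -> U) (a : T -> R) :
  (forall t, a t != 0 -> h (g t) = t) -> fsummable (a \o h) -> fsummable a.
Proof.
move=> hg [M ahM]; exists M => s us.
rewrite (bigID (fun t => a t == 0)) /= big1 ?add0r => [|t /eqP//].
rewrite -big_filter; set s' := [seq t <- s | a t != 0].
have E : map h (map g s') = s'.
  rewrite -map_comp -[RHS]map_id; apply/eq_in_map => t.
  by rewrite mem_filter => /andP[/hg].
rewrite -E big_map; apply: ahM.
by apply: (@map_uniq _ _ h); rewrite E filter_uniq.
Qed.

(** A finite set of pairs lies in the first [m] blocks for some [m]. Entries beyond the length [N k]
    of a block are set to 0. *)
Lemma fsummable_blocks (N : nat -> nat) (a : nat -> nat -> R) (b : nat -> R) (M : R) :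
  (forall k l, 0 <= a k l) -> (forall k, \sum_(l < N k) a k l <= b k) ->
  (forall m, \sum_(k < m) b k <= M) ->
  fsummable (fun t : nat * nat => if (t.2 < N t.1)%N then a t.1 t.2 else 0).
Proof.
move=> a0 ab bM; exists M => s us.
have [m sm] : exists m, forall t, t \in s -> (t.1 < m)%N.
  exists (\max_(t <- s) t.1).+1 => t ts; rewrite ltnS.
  exact: (@leq_bigmax_seq _ s xpredT (fun t => t.1)).
pose r := [seq (k, l) | k <- iota 0 m, l <- iota 0 (N k)].
rewrite -big_mkcond /= -big_filter.
have E t : t \in [seq t <- s | (t.2 < N t.1)%N] ->
    a t.1 t.2 = (if (t.2 < N t.1)%N then a t.1 t.2 else 0).
  by rewrite mem_filter => /andP[->].
apply: (@le_trans _ _ (\sum_(t <- r) a t.1 t.2)).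
  apply: (ler_sum_uniq (a := fun t => a t.1 t.2)) => //.
  - exact: filter_uniq.
  - apply: allpairs_uniq_dep; first exact: iota_uniq.
      by move=> k _; exact: iota_uniq.
    by move=> [x1 x2] [y1 y2] _ _ /= [-> ->].
  - move=> [k l]; rewrite mem_filter /= => /andP[lN ts].
    apply/allpairsPdep; exists k, l; split=> //; rewrite mem_iota add0n//=.
    exact: (sm _ ts).
rewrite big_allpairs_dep /=; apply: le_trans (bM m).
have E0 n : iota 0 n = index_iota 0 n by rewrite /index_iota subn0.
rewrite E0 big_mkord; apply: ler_sum => k _.
apply: le_trans (ab k).
by rewrite E0 big_mkord.
Qed.

Lemma nneseries_fsummable (a : nat -> R) : (forall j, 0 <= a j) ->
  (\sum_(0 <= j <oo) (a j)%:E < +oo)%E <-> fsummable a.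
Proof.
move=> a0; split=> [afin|[M aM]].
  have a_ge0 j : (0 <= (a j)%:E)%E by rewrite lee_fin.
  exists (fine (\sum_(0 <= j <oo) (a j)%:E)) => s us.
  rewrite -lee_fin fineK; last first.
    by rewrite ge0_fin_numE//; apply: nneseries_ge0 => j _ _; exact: a_ge0.
  pose m := (\max_(t <- s) t).+1.
  apply: (@le_trans _ _ (\sum_(0 <= j < m) a j)%:E).
    rewrite lee_fin; apply: ler_sum_uniq => //; first exact: iota_uniq.
    move=> j js; rewrite mem_index_iota /= ltnS.
    exact: (@leq_bigmax_seq _ s xpredT id j).
  by rewrite -sumEFin; apply: nneseries_lim_ge => j _ _.
apply: (@le_lt_trans _ _ M%:E); last exact: ltry.
apply: lime_le; first by apply: is_cvg_nneseries => j _ _; rewrite lee_fin.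
apply: nearW => n; rewrite sumEFin lee_fin; apply: aM; exact: iota_uniq.
Qed.

Lemma lspace_fsummable (q : R) (a : nat -> R) : 0 < q ->
  lspace q%:E a <-> fsummable (fun j => `|a j| `^ q).
Proof.
move=> q0; rewrite -nneseries_fsummable => [|j]; last exact: powR_ge0.
rewrite /lspace /lnorm /= Lnorm_counting//.
rewrite (_ : (\sum_(k <oo) _)%E = (\sum_(0 <= k <oo) (`|a k| `^ q)%:E)%E); last first.
  by apply: eq_eseriesr => k _ /=; rewrite -poweR_EFin.
split=> [|h]; last exact: poweR_lty.
by rewrite !ltey; apply: contraNN => /eqP ->; rewrite poweRyr// invr_eq0 gt_eqF.
Qed.

Lemma hoelder_conjugate_EFin (p : R) : 1 < p ->
  hoelder_conjugate p%:E = (p / (p - 1))%:E.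
Proof.
move=> p1; rewrite /hoelder_conjugate /= eqe gt_eqF ?(lt_trans ltr01)//.
by rewrite -EFinB inver subr_eq0 gt_eqF.
Qed.

End finite_sums.

Lemma nat_pair_bijection : exists (c : nat * nat -> nat) (d : nat -> nat * nat),
  cancel c d /\ cancel d c.
Proof.
have /card_esym/ppcard_eqP[f] := card_nat2.
exists (f^-1)%FUN, f; split=> x; first by rewrite invK// inE.
by rewrite funK// inE.
Qed.

(** * Vector-valued sequences *)

Section sequence_families.
Variables (R : realType) (E : banachLatticeType R) (q : R).
Hypothesis q0 : 0 < q.

Lemma dual0 : dual (fun _ : E => 0 : R^o).
Proof.
split; first by move=> a u v; rewrite scaler0 addr0.
exact: cst_continuous.
Qed.

Lemma dualZ (a : R) (f : E -> R^o) : dual f -> dual (fun v => a *: f v).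
Proof.
move=> [fl fc]; split=> [b u v|v]; first by rewrite fl scalerDr !scalerA mulrC.
by apply: cvgZr; exact: fc.
Qed.

(** A positive [f] is itself the supremum of [f] and [- f]; the chosen supremum agrees with it on
    the cone, and [x = x^+ - x^-] extends the equality. *)
Lemma dual_abs_pos (f : E -> R^o) : dual f -> dual_le 0 f -> dual_abs f = f.
Proof.
move=> df f0; have abs_f : is_dual_abs f f.
  split=> // x x0.
  by apply: le_trans (f0 x x0); rewrite oppr_le0; exact: f0.
have : is_dual_abs f (dual_abs f) by apply: (xgetI f abs_f).
move=> [[gl _] fg _ /(_ f df)] gf.
have {}gf : dual_le (dual_abs f) f by apply: gf => //; case: abs_f.
have E0 x : 0 <=v x -> dual_abs f x = f x.
  by move=> x0; apply/eqP; rewrite eq_le gf// fg.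
have [fl _] := df.
apply/funext => x; rewrite (rpos_sub x) (linfunB gl) (linfunB fl).
by rewrite !E0//; exact: rpos_ge0.
Qed.

(** This and the next three definitions extend [dual_weak], [dual_eps_pos], [cohen] and [lpi] to
    arbitrary index types, so that families of pairs can be handled directly. *)
Definition weak_family (T : eqType) (f : T -> E -> R) :=
  (forall t, dual (f t : E -> R^o)) /\
  forall v, fsummable (fun t => `|f t v| `^ q).

Definition pos_family (T : eqType) (f : T -> E -> R) :=
  [/\ forall t, dual (f t : E -> R^o),
      forall t v, 0 <=v v -> 0 <= f t v &
      forall v, 0 <=v v -> fsummable (fun t => f t v `^ q)].

Definition cohen_family (T : eqType) (x : T -> E) := forall f,
  weak_family f -> fsummable (fun t => `|f t (x t)|).

Definition pi_family (T : eqType) (x : T -> E) := forall f,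
  pos_family f -> fsummable (fun t => f t (modulus (x t))).

Lemma pos_family_inj (T U : eqType) (h : U -> T) f :
  injective h -> pos_family f -> pos_family (f \o h).
Proof.
move=> hI [df f0 fs]; split=> [t|t|v v0]; [exact: df|exact: f0|].
exact: (fsummable_inj hI (fs v v0)).
Qed.

Lemma pi_family_modulus_le (T : eqType) (x y z : T -> E) :
  (forall t, modulus (x t) <=v modulus (y t) + modulus (z t)) ->
  pi_family y -> pi_family z -> pi_family x.
Proof.
move=> xyz py pz f pf; have [df f0 _] := pf.
apply: fsummable_le (fsummableD (py f pf) (pz f pf)); first exact: ler01.
move=> t; have [fl _] := df t; rewrite mul1r -(linfunD fl).
by apply: posfun_homo => //; exact: f0.
Qed.

Lemma pi_familyZ (T : eqType) (a : R) (x : T -> E) :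
  pi_family x -> pi_family (fun t => a *: x t).
Proof.
move=> px f pf; have [df f0 _] := pf.
apply: (fsummable_le (normr_ge0 a)) (px f pf) => t.
by have [fl _] := df t; rewrite modulusZ (linfunZ fl).
Qed.

Lemma pi_family_supp (T U : eqType) (h : U -> T) (g : T -> U) (x : T -> E) :
  injective h -> (forall t, x t != 0 -> h (g t) = t) ->
  pi_family (x \o h) -> pi_family x.
Proof.
move=> hI hg px f pf; have [df _ _] := pf.
apply: (@fsummable_supp _ _ _ h g); last exact: px (pos_family_inj hI pf).
move=> t ft; apply: hg; apply: contraNneq ft => ->.
by have [fl _] := df t; rewrite modulus0 (linfun0 fl).
Qed.

(** A weak family testing [x \o h] extends by 0 off the range of [h], recognized by [h (g t) == t],
    to one testing [x]. *)
Lemma cohen_family_inj (T U : eqType) (h : U -> T) (g : T -> U) (x : T -> E) :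
  cancel h g -> cohen_family x -> cohen_family (x \o h).
Proof.
move=> hg cx f [df fs].
pose F t : E -> R := if h (g t) == t then f (g t) else fun=> 0.
have FE u : F (h u) = f u by rewrite /F hg eqxx.
have wF : weak_family F.
  split=> [t|v]; first by rewrite /F; case: ifP => _; [exact: df|exact: dual0].
  apply: (@fsummable_supp _ _ _ h g) => [t|].
    rewrite /F; case: (eqVneq (h (g t)) t) => // _.
    by rewrite normr0 powR0 ?eqxx// gt_eqF.
  rewrite (_ : _ \o h = fun u => `|f u v| `^ q); first exact: fs.
  by apply/funext => u /=; rewrite FE.
have := fsummable_inj (can_inj hg) (cx F wF).
rewrite (_ : _ \o h = fun u => `|f u (x (h u))|)//.
by apply/funext => u /=; rewrite FE.
Qed.

End sequence_families.

Section sequence_spaces.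
Variables (R : realType) (E : banachLatticeType R) (p : R).
Hypothesis p1 : 1 < p.

Definition conjugate_exponent : R := p / (p - 1).
Local Notation q := conjugate_exponent.

Lemma conjugate_exponent_gt0 : 0 < q.
Proof. by rewrite divr_gt0 ?subr_gt0// (lt_trans ltr01). Qed.

Lemma conjugate_exponent_ge1 : 1 <= q.
Proof. by rewrite ler_pdivlMr ?subr_gt0// mul1r lerBlDr lerDl. Qed.

Lemma conjugate_exponentP : p^-1 + q^-1 = 1.
Proof.
rewrite /conjugate_exponent; field.
by rewrite subr_eq0 !gt_eqF// (lt_trans ltr01).
Qed.

Lemma dual_weak_family (f : nat -> E -> R^o) : dual_weak p f <-> weak_family q f.
Proof.
rewrite /dual_weak /= hoelder_conjugate_EFin//; split=> -[df fs]; split=> // v;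
  by have /(lspace_fsummable _ conjugate_exponent_gt0) := fs v.
Qed.

Lemma dual_eps_pos_family (f : nat -> E -> R^o) :
  dual_eps_pos p f <-> pos_family q f.
Proof.
rewrite /dual_eps_pos /dual_eps /= hoelder_conjugate_EFin//; split.
  move=> [[df fs] f0]; split=> // v v0.
  have /(lspace_fsummable _ conjugate_exponent_gt0) := fs v v0.
  congr fsummable; apply/funext => j; rewrite dual_abs_pos// ger0_norm//.
  exact: f0.
move=> [df f0 fs]; split; last by move=> j v; exact: f0.
split=> // v v0; apply/(lspace_fsummable _ conjugate_exponent_gt0).
have := fs v v0; congr fsummable; apply/funext => j.
rewrite dual_abs_pos// ?ger0_norm//; first exact: f0.
by move=> w; exact: f0.
Qed.

Lemma cohenP (x : nat -> E) : cohen p E x <-> cohen_family q x.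
Proof.
split=> cx f /dual_weak_family/cx; rewrite nneseries_fsummable//.
Qed.

Lemma lpiP (x : nat -> E) : lpi p E x <-> pi_family q x.
Proof.
split=> cx f pf.
  have [_ f0 _] := pf; move/dual_eps_pos_family/cx : pf.
  by rewrite /pi_sum nneseries_fsummable// => j; apply/f0/modulus_ge0.
have := cx f; move/dual_eps_pos_family : pf => pf; have [_ f0 _] := pf.
by rewrite /pi_sum nneseries_fsummable// => [/(_ pf)//|j]; apply/f0/modulus_ge0.
Qed.

End sequence_spaces.

(** * Limits and domination in the positive cone *)

Section positive_cone.
Variables (R : realType) (E : banachLatticeType R).

(** The vector [(x - l)^+] is dominated by [(s k - l)^+], whose norm tends to 0. *)
Lemma rle_cvg (x l : E) (s : nat -> E) (n0 : nat) :
  (forall n, (n0 <= n)%N -> x <=v s n) -> s @ \oo --> l -> x <=v l.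
Proof.
move=> xs sl; apply/rsubr_ge0.
suff xl0 : rpos (x - l) = 0.
  by have := rleN (rle_rpos (x - l)); rewrite xl0 oppr0 opprB.
apply/eqP; rewrite -normr_eq0 eq_le normr_ge0 andbT.
apply/ler_addgt0Pr => e e0; rewrite add0r.
have /cvgrPdist_lt/(_ e e0) [m _ sm] := sl.
pose k := maxn m n0.
have := sm k (leq_maxl _ _); rewrite distrC => /ltW; apply: le_trans.
apply: le_trans (norm_rpos_le _); apply: norm_homo; first exact: rpos_ge0.
by apply: rpos_homo; apply: rleD2r; apply: xs; exact: leq_maxr.
Qed.

(** Completeness gives [Z] as the sum of an absolutely convergent series, whose partial sums past
    [k] dominate the [k]-th term. *)
Lemma exists_dominating (z : nat -> E) : (forall k, 0 <=v z k) ->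
  (forall k, `|z k| <= 1) -> exists Z : E, forall k, 2^-1 ^+ k *: z k <=v Z.
Proof.
move=> z0 z1; pose w k : E := 2^-1 ^+ k *: z k.
have w0 k : 0 <=v w k by apply: rle_scale_ge0 => //; rewrite exprn_ge0.
have cw : cvgn (series w).
  apply: normed_cvg; apply: (@series_le_cvg _ _ (geometric 1 2^-1)).
  - by move=> n; exact: normr_ge0.
  - by move=> n; rewrite /geometric /= mul1r exprn_ge0.
  - move=> n; rewrite /= /w normrZ ger0_norm ?exprn_ge0// /geometric /= mul1r.
    by rewrite ler_piMr// exprn_ge0.
  - by apply: is_cvg_geometric_series; rewrite gtr0_norm; lra.
exists (limn (series w)) => k; apply: (@rle_cvg _ _ _ k.+1) cw => n kn.
rewrite /series /= big_mkord (bigD1 (Ordinal kn))//=; apply: rleDl.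
by apply: rsum_ge0 => i _.
Qed.

End positive_cone.

Lemma sum_half_le (R : realType) m : \sum_(k < m) 2^-1 ^+ k <= 2 :> R.
Proof.
have -> : \sum_(k < m) 2^-1 ^+ k = 2 - 2 * 2^-1 ^+ m :> R.
  elim: m => [|m IH]; first by rewrite big_ord0 expr0; ring.
  by rewrite big_ord_recr /= IH exprS; field.
by rewrite lerBlDr lerDl mulr_ge0// exprn_ge0.
Qed.

(** * Gluing the blocks *)

Section assembling_blocks.
Variables (R : realType) (E : banachLatticeType R) (p q : R).
Hypotheses (p0 : 0 < p) (q1 : 1 <= q) (pq : p^-1 + q^-1 = 1).

Let q0 : 0 < q. Proof. exact: lt_le_trans q1. Qed.

(** Young's inequality for [N^(-1/p)] and [t], with [1/p] and [1/q] bounded by 1. Over a block of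
    length [N] the terms [1/N] add up to 1. *)
Lemma young (N : nat) (t : R) : (0 < N)%N -> 0 <= t ->
  N%:R `^ (- p^-1) * t <= N%:R^-1 + t `^ q.
Proof.
move=> N0 t0; have NR0 : (0 : R) < N%:R by rewrite ltr0n.
apply: le_trans (conjugate_powR (powR_ge0 _ _) t0 p0 q0 pq) _.
have p1 : 1 <= p.
  by rewrite -invf_le1// -pq lerDl invr_ge0 ltW.
rewrite -powRrM mulNr mulVf ?gt_eqF// powR_inv1 ?(ltW NR0)//.
by apply: lerD; rewrite ler_pdivrMr// ler_peMr// ?invr_ge0 ?powR_ge0 ?(ltW NR0).
Qed.

(** The [k]-th block has pairing at least [8^k], weight [4^-k] in [u] and weight [2^-k] in the test
    family. Each block thus contributes at least 1 to the pairing, while its share of a positive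
    test sum is at most a multiple of [2^-k]. *)
Lemma pi_not_cohen_pair : (forall C, rademacher_block E p q C) ->
  exists u : nat * nat -> E,
  [/\ forall t, 0 <=v u t, pi_family q u & ~ cohen_family q u].
Proof.
move=> blk.
have /choice[B BP] : forall k, exists b : nat * (nat -> E -> R) * (nat -> E) * E,
    let: (N, g, u, z) := b in
    [/\ (0 < N)%N, `|z| <= 1 & forall l, dual (g l : E -> R^o)] /\
    [/\ forall v, \sum_(l < N) `|g l v| `^ q <= `|v| `^ q,
        forall l, 0 <=v u l,
        forall l, u l <=v N%:R `^ (- p^-1) *: z &
        8 ^+ k <= \sum_(l < N) g l (u l)].
  by move=> k; have [N [g [u [z h]]]] := blk (8 ^+ k); exists (N, g, u, z).
pose N k := (B k).1.1.1; pose g k := (B k).1.1.2.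
pose x k := (B k).1.2; pose z k := (B k).2.
have {}BP k : [/\ (0 < N k)%N, `|z k| <= 1 & forall l, dual (g k l : E -> R^o)] /\
    [/\ forall v, \sum_(l < N k) `|g k l v| `^ q <= `|v| `^ q,
        forall l, 0 <=v x k l,
        forall l, x k l <=v (N k)%:R `^ (- p^-1) *: z k &
        8 ^+ k <= \sum_(l < N k) g k l (x k l)].
  by have := BP k; rewrite /N /g /x /z; case: (B k) => [[[? ?] ?] ?].
have N0 k : (0 < N k)%N by have [[]] := BP k.
have NR0 k : (0 : R) < (N k)%:R by rewrite ltr0n.
have z1 k : `|z k| <= 1 by have [[]] := BP k.
have gd k l : dual (g k l : E -> R^o) by have [[]] := BP k.
have gq k v : \sum_(l < N k) `|g k l v| `^ q <= `|v| `^ q by have [_ []] := BP k.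
have x0 k l : 0 <=v x k l by have [_ []] := BP k.
have xz k l : x k l <=v (N k)%:R `^ (- p^-1) *: z k by have [_ []] := BP k.
have gx k : 8 ^+ k <= \sum_(l < N k) g k l (x k l) by have [_ []] := BP k.
have z0 k : 0 <=v z k.
  have a0 : 0 < (N k)%:R `^ (- p^-1) :> R by rewrite powR_gt0.
  rewrite -[z k]scale1r -(mulVf (lt0r_neq0 a0)) -scalerA.
  apply: rle_scale_ge0; first by rewrite invr_ge0 ltW.
  exact: rle_trans (x0 k 0%N) (xz k 0%N).
have h0 k : (0 : R) <= 2^-1 ^+ k by rewrite exprn_ge0.
have h1 k : (2^-1 : R) ^+ k <= 1 by apply: exprn_ile1 => //; rewrite invf_le1// ler1n.
have [Z Zz] := exists_dominating z0 z1.
have Z0 : 0 <=v Z by apply: rle_trans (Zz 0%N); exact: rle_scale_ge0.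
pose u (t : nat * nat) : E :=
  if (t.2 < N t.1)%N then (2^-1 ^+ t.1 * 2^-1 ^+ t.1) *: x t.1 t.2 else 0.
have u0 t : 0 <=v u t.
  rewrite /u; case: ifP => _; last exact: rle_refl.
  by apply: rle_scale_ge0 => //; rewrite mulr_ge0.
exists u; split=> //.
- move=> f [df f0 fs].
  have [M fM] := fs Z Z0.
  have M0 : 0 <= M by have := fM [::] isT; rewrite big_nil.
  pose a k l := f (k, l) ((2^-1 ^+ k * 2^-1 ^+ k) *: x k l).
  rewrite (_ : (fun t => _) = fun t => if (t.2 < N t.1)%N then a t.1 t.2 else 0); last first.
    apply/funext => -[k l] /=; rewrite modulus_id// /u /=; case: ifP => // _.
    by have [fl _] := df (k, l); exact: linfun0 fl.
  apply: (@fsummable_blocks _ _ _ (fun k => (1 + M) * 2^-1 ^+ k) ((1 + M) * 2)) => [k l|k|m].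
  + by apply: f0; apply: rle_scale_ge0 => //; rewrite mulr_ge0.
  (* One factor [2^-k] brings [z k] below [Z]; the other is kept for the convergence over [k]. *)
  + have al l : a k l <= 2^-1 ^+ k * ((N k)%:R^-1 + f (k, l) Z `^ q).
      have [fl _] := df (k, l); rewrite /a -scalerA (linfunZ fl).
      apply: ler_wpM2l => //; apply: le_trans (young (N0 k) (f0 _ _ Z0)).
      rewrite -(linfunZ fl); apply: (posfun_homo fl (f0 (k, l))).
      apply: rle_trans (rle_scale (h0 k) (xz k l)) _.
      by rewrite scalerA mulrC -scalerA; apply: rle_scale; [exact: powR_ge0|exact: Zz].
    apply: (@le_trans _ _ (\sum_(l < N k) 2^-1 ^+ k * ((N k)%:R^-1 + f (k, (l : nat)) Z `^ q))).
      by apply: ler_sum => l _; exact: al.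
    rewrite -mulr_sumr mulrC; apply: ler_wpM2r => //.
    rewrite big_split /= sumr_const card_ord -[X in X + _]mulr_natl mulfV ?gt_eqF// lerD2l.
    have := fM [seq (k, l) | l <- iota 0 (N k)].
    rewrite map_inj_uniq => [|? ? []//]; rewrite iota_uniq big_map => /(_ isT).
    by rewrite -[in iota _ (N k)](subn0 (N k)) (big_mkord xpredT).
  + by rewrite -mulr_sumr; apply: ler_wpM2l; [exact: addr_ge0|exact: sum_half_le].
- move=> cu; pose f (t : nat * nat) : E -> R :=
    if (t.2 < N t.1)%N then fun v => 2^-1 ^+ t.1 * g t.1 t.2 v else fun=> 0.
  have wf : weak_family q f.
    split=> [t|v].
      rewrite /f; case: ifP => _; last exact: dual0.
      exact: (dualZ (2^-1 ^+ t.1) (gd t.1 t.2)).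
    pose a k l := `|2^-1 ^+ k * g k l v| `^ q.
    rewrite (_ : (fun t => _) = fun t => if (t.2 < N t.1)%N then a t.1 t.2 else 0); last first.
      apply/funext => -[k l] /=; rewrite /f /=; case: ifP => // _.
      by rewrite normr0 powR0 ?gt_eqF.
    apply: (@fsummable_blocks _ _ _ (fun k => `|v| `^ q * 2^-1 ^+ k) (`|v| `^ q * 2)) => [k l|k|m].
    + exact: powR_ge0.
    + apply: (@le_trans _ _ (\sum_(l < N k) 2^-1 ^+ k * `|g k l v| `^ q)).
        apply: ler_sum => l _; rewrite /a normrM powRM// ger0_norm//.
        apply: ler_wpM2r; first exact: powR_ge0.
        (* [(2^-k)^q <= 2^-k], as [q >= 1] and the base is at most 1. *)
        rewrite -[leRHS]powRr1//; apply: ger_powR q1.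
        by rewrite exprn_gt0 ?invr_gt0//= h1.
      by rewrite -mulr_sumr mulrC; apply: ler_wpM2r.
    + by rewrite -mulr_sumr; apply: ler_wpM2l; [exact: powR_ge0|exact: sum_half_le].
  have [M cM] := cu f wf.
  have M0 : 0 <= M by have := cM [::] isT; rewrite big_nil.
  (* The first [m] blocks contribute at least [m > M], against the bound [M]. *)
  have [m mM] : exists m, M < m%:R by exists (Num.bound M); exact: archi_boundP.
  have := cM [seq (k, l) | k <- iota 0 m, l <- iota 0 (N k)].
  rewrite allpairs_uniq_dep ?iota_uniq//; last 2 first.
  + by move=> k _; exact: iota_uniq.
  + by move=> [x1 x2] [y1 y2] _ _ /= [-> ->].
  move=> /(_ isT); apply/negP; rewrite -ltNge.
  apply: lt_le_trans mM _.
  rewrite big_allpairs_dep /=.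
  have E0 n : iota 0 n = index_iota 0 n by rewrite /index_iota subn0.
  rewrite E0 big_mkord -[m in m%:R]card_ord -sumr_const.
  apply: ler_sum => k _; rewrite E0 big_mkord.
  apply: (@le_trans _ _ (\sum_(l < N k) 8^-1 ^+ k * g k l (x k l))).
    rewrite -mulr_sumr; apply: le_trans (ler_wpM2l _ (gx k)).
      by rewrite -exprMn mulVf ?expr1n.
    by rewrite exprn_ge0.
  apply: ler_sum => l _; apply: le_trans (ler_norm _).
  rewrite le_eqVlt; apply/orP; left; apply/eqP.
  rewrite /f /u /= ltn_ord; have [gl _] := gd k l; rewrite (linfunZ gl) !mulrA -!exprMn.
  by congr (_ ^+ _ * _); field.
Qed.

End assembling_blocks.

(** * Coordinates and the norm of [lpi] *)

Section pi_norm_coordinate.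
Variables (R : realType) (E : banachLatticeType R) (p : R).
Hypothesis p1 : 1 < p.

Local Notation q := (conjugate_exponent p).

(** Hahn-Banach for the sublinear [|x^+|]: it vanishes at negative vectors, which makes [f]
    positive, and equals the norm at [v]. *)
Lemma exists_norming_positive (v : E) : 0 <=v v -> exists f : E -> R,
  [/\ linear (f : E -> R^o), forall x, 0 <=v x -> 0 <= f x,
      forall x, `|f x| <= `|x| & f v = `|v|].
Proof.
move=> v0; have sub_pos : sublinear (fun x : E => `|rpos x|).
  split=> [x y|a x a0].
    by apply: le_trans (ler_normD _ _); apply: norm_homo (rposD x y); exact: rpos_ge0.
  rewrite -[X in _ <= X * _](gtr0_norm a0) -normrZ; apply: norm_homo.
    exact: rpos_ge0.
  exact/rposZ_le/ltW.
have [f [fl fle fv]] := hahn_banach v sub_pos.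
have f0 x : 0 <=v x -> 0 <= f x.
  move=> x0; rewrite -oppr_le0 -(linfunN fl); apply: le_trans (fle _) _.
  by rewrite rposN rpos_id// subrr normr0.
exists f; split=> // [x|]; last by rewrite fv rpos_id.
rewrite -[leRHS]mul1r; apply: posfun_norm => // w w0.
by rewrite mul1r; apply: le_trans (fle w) (norm_rpos_le w).
Qed.

(** Test with a positive functional norming [modulus (w i)] at the index [i] and 0 elsewhere.
    Convergence in [pi_norm] thus implies coordinatewise convergence. *)
Lemma norm_coord_le_pi_norm (w : nat -> E) (i : nat) :
  (`|w i|%:E <= pi_norm p E w)%E.
Proof.
have [phi [phil phi0 phile phiw]] := exists_norming_positive (modulus_ge0 (w i)).
have phid : dual (phi : E -> R^o).
  by apply: (@bounded_dual _ _ _ phil 1) => x; rewrite mul1r.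
pose f (j : nat) : E -> R := if j == i then phi else fun=> 0.
have fd j : dual (f j : E -> R^o) by rewrite /f; case: eqP => _ //; exact: dual0.
have f0 j x : 0 <=v x -> 0 <= f j x by rewrite /f; case: eqP => _ //; exact: phi0.
have q0 : 0 < q by exact: conjugate_exponent_gt0.
have f_sum v : forall s : seq nat, uniq s -> \sum_(j <- s) `|f j v| `^ q <= `|phi v| `^ q.
  move=> s us; have h j : j != i -> `|f j v| `^ q = 0.
    by rewrite /f => /negPf ->; rewrite normr0 powR0// gt_eqF.
  rewrite (bigID (pred1 i)) /= [X in _ + X]big1 ?addr0//.
  rewrite (eq_bigr (fun=> `|phi v| `^ q)) => [|j /eqP ->]; last by rewrite /f eqxx.
  rewrite big_const_seq iter_addr_0.
  by rewrite (eq_count (a2 := pred1 i))// count_uniq_mem//; case: (_ \in _) => //=; exact: powR_ge0.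
have pf : pos_family q f.
  split=> // v v0; exists (`|phi v| `^ q) => s us; apply: le_trans (f_sum v s us).
  by apply: ler_sum => j _; rewrite ger0_norm//; exact: f0.
have eps1 : (eps_norm p f <= 1)%E.
  apply: ub_ereal_sup => _ [v [v0 v1] <-].
  rewrite /lnorm hoelder_conjugate_EFin// Lnorm_counting//.
  have le1 : (\sum_(k <oo) `|(EFin \o (fun j => dual_abs (f j) v)) k| `^ q <= 1)%E.
    apply: lime_le.
      by apply: is_cvg_nneseries => j _ _; exact: poweR_ge0.
    apply: nearW => n.
    have fE j : dual_abs (f j) = f j by apply: dual_abs_pos => // x; exact: f0.
    under eq_bigr do rewrite /= fE.
    rewrite (sumEFin _ _ (fun j => `|f j v| `^ q)) lee_fin.
    apply: le_trans (f_sum v _ (iota_uniq _ _)) _.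
    have <- : 1 `^ q = 1 :> R by rewrite powR1.
    apply: ge0_ler_powR; rewrite ?nnegrE ?(ltW q0)//.
    exact: le_trans (phile v) v1.
  rewrite -[leRHS](poweR1r q^-1); apply: gt0_ler_poweR => //.
  - by rewrite invr_ge0 ltW.
  - by rewrite in_itv/= leey andbT; apply: nneseries_ge0 => j _ _; rewrite lee_fin; exact: powR_ge0.
  - by rewrite in_itv/= leey andbT.
apply: (@le_trans _ _ (pi_sum f w)); last first.
  by apply: ereal_sup_ubound; exists f => //; split=> //; exact/dual_eps_pos_family.
have fw0 j : (0 <= (f j (modulus (w j)))%:E)%E.
  by rewrite lee_fin; apply/f0/modulus_ge0.
apply: le_trans (nneseries_lim_ge i.+1 _) => [|j _ _]; last exact: fw0.
rewrite big_mkord big_ord_recr /= [f i]/f eqxx phiw norm_modulus leeDr//.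
by apply: sume_ge0 => j _; exact: fw0.
Qed.

End pi_norm_coordinate.

(** * The sublattice of row multiples *)

Section multiples_of_a_family.
Variables (R : realType) (E : banachLatticeType R) (p : R).
Hypothesis p1 : 1 < p.
Variables (c : nat * nat -> nat) (d : nat -> nat * nat).
Hypotheses (cK : cancel c d) (dK : cancel d c).
Variable u : nat -> E.
Hypotheses (u0 : forall j, 0 <=v u j) (u_lpi : lpi p E u) (u_cohen : ~ cohen p E u).

Local Notation q := (conjugate_exponent p).

Let q0 : 0 < q. Proof. exact: conjugate_exponent_gt0. Qed.

(* The sequences whose [k]-th row is a multiple [a k] of [u]; being solvable in
   [a] is a coordinatewise condition, hence closed. *)
Definition row_multiples : set (nat -> E) :=
  [set y | lpi p E y /\
    exists a : nat -> R, forall k j, y (c (k, j)) = a k *: u j].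

Let row_inj k : injective (fun j => c (k, j)).
Proof. by move=> i j /(can_inj cK)[]. Qed.

Lemma exists_nonzero : exists j, u j != 0.
Proof.
apply: contrapT => nu; apply/u_cohen/cohenP => // f [df _]; exists 0 => s _.
rewrite big1// => j _.
have -> : u j = 0 by apply/eqP/negPn/negP => uj; apply: nu; exists j.
by have [fl _] := df j; rewrite (linfun0 fl) normr0.
Qed.

Lemma lpi_dominated (a : R) (x y z : nat -> E) :
  (forall t, modulus (x t) <=v modulus (a *: y t) + modulus (z t)) ->
  lpi p E y -> lpi p E z -> lpi p E x.
Proof.
move=> xyz /lpiP py /lpiP pz; apply/lpiP => //.
exact: (pi_family_modulus_le xyz (pi_familyZ a (py p1)) (pz p1)).
Qed.

Lemma row_multiples_riesz : riesz_subspace row_multiples.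
Proof.
split.
- split; last by exists (fun=> 0) => k j; rewrite scale0r.
  apply/lpiP => // f [df _ _]; exists 0 => s _; rewrite big1// => j _.
  by have [fl _] := df j; rewrite modulus0 (linfun0 fl).
- move=> r x y [lx [a xa]] [ly [b yb]]; split.
    apply: (@lpi_dominated r _ x y) => // t.
    exact: modulusD.
  exists (fun k => r * a k + b k) => k j.
  by rewrite -[LHS]/(r *: x (c (k, j)) + y (c (k, j))) xa yb scalerDl scalerA.
- move=> x y [lx [a xa]] [ly [b yb]]; split.
    apply: (@lpi_dominated 1 _ x y) => // t; rewrite scale1r.
    exact: modulus_rjoin.
  exists (fun k => Num.max (a k) (b k)) => k j.
  by rewrite -[LHS]/(rjoin (x (c (k, j))) (y (c (k, j)))) xa yb rjoin_scale.
- move=> x y [lx [a xa]] [ly [b yb]]; split.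
    apply: (@lpi_dominated 1 _ x y) => // t; rewrite scale1r.
    exact: modulus_rmeet.
  exists (fun k => Num.min (a k) (b k)) => k j.
  by rewrite -[LHS]/(rmeet (x (c (k, j))) (y (c (k, j)))) xa yb rmeet_scale.
Qed.

(** A functional norming a nonzero [u j0] recovers the coefficient of a row continuously from its
    entry at [j0], and [pi_norm] controls every coordinate. *)
Lemma row_multiples_closed :
  norm_closed_in (lpi p E) (pi_norm p E) row_multiples.
Proof.
move=> x lx xL; split=> //; have [j0 uj0] := exists_nonzero.
have [phi [phil _ phile phiu]] := exists_norming_positive (u0 j0).
have nu0 : 0 < `|u j0| by rewrite normr_gt0.
exists (fun k => phi (x (c (k, j0))) / `|u j0|) => k j.
set a := phi _ / _.
apply/eqP; rewrite -subr_eq0 -normr_eq0 eq_le normr_ge0 andbT.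
apply/ler_addgt0Pr => e e0; rewrite add0r.
(* With this [K] the error of the entry and that of the coefficient, times [|u j|], add up to
   [e]. *)
pose K := 1 + `|u j| / `|u j0|.
have K0 : 0 < K by rewrite ltr_wpDr// divr_ge0.
have [y [_ [b yb]] xy] := xL (e / K) (divr_gt0 e0 K0).
have coord i : `|x i - y i| <= e / K.
  by rewrite -lee_fin; apply: le_trans (norm_coord_le_pi_norm p1 (x - y) i) (ltW xy).
have ab : `|b k - a| <= e / K / `|u j0|.
  rewrite ler_pdivlMr// -[X in _ * X](gtr0_norm nu0) -normrM mulrBl divfK ?gt_eqF//.
  rewrite distrC -phiu -(linfunZ phil) -(linfunB phil).
  by apply: le_trans (phile _) _; rewrite -yb; exact: coord.
have -> : x (c (k, j)) - a *: u j = (x (c (k, j)) - y (c (k, j))) + (b k - a) *: u j.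
  by rewrite yb scalerBl addrA subrK.
apply: le_trans (ler_normD _ _) _; rewrite normrZ.
apply: (@le_trans _ _ (e / K + e / K / `|u j0| * `|u j|)).
  by apply: lerD; [exact: coord|apply: ler_wpM2r].
have -> : e / K + e / K / `|u j0| * `|u j| = e / K * K.
  by rewrite /K; ring.
by rewrite divfK// gt_eqF.
Qed.

Definition row_copy (k : nat) : nat -> E :=
  fun i => if (d i).1 == k then u (d i).2 else 0.

Lemma row_copyE k l j : row_copy k (c (l, j)) = (l == k)%:R *: u j.
Proof. by rewrite /row_copy cK /=; case: eqP => _; rewrite ?scale1r ?scale0r. Qed.

Lemma row_copy_mem k : row_multiples (row_copy k).
Proof.
split; last by exists (fun l => (l == k)%:R) => l j; exact: row_copyE.
apply/lpiP => //; apply: (@pi_family_supp _ _ _ _ _ (fun j => c (k, j)) (fun i => (d i).2)).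
- exact: row_inj.
- move=> t; rewrite /row_copy; case: (eqVneq (d t).1 k) => [<- _|_]; last by rewrite eqxx.
  by rewrite -surjective_pairing dK.
- have /lpiP := u_lpi => /(_ p1); congr pi_family; apply/funext => j /=.
  by rewrite row_copyE eqxx scale1r.
Qed.

(** If [n] elements generated, the first [n.+1] row copies of [u] would factor the identity matrix
    of size [n.+1] through dimension [n]. *)
Lemma row_multiples_infinite : ~ finite_dimensional row_multiples.
Proof.
move=> [n [b [bL gen]]].
have /choice[a ba] : forall i, exists a : nat -> R, forall k j, b i (c (k, j)) = a k *: u j.
  by move=> i; have [_] := bL i.
have [j0 uj0] := exists_nonzero.
have /choice[w wE] : forall k, exists w : 'I_n -> R, row_copy k = \sum_(i < n) w i *: b i.
  by move=> k; apply: gen; exact: row_copy_mem.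
pose W : 'M[R]_(n.+1, n) := \matrix_(k, i) w k i.
pose A : 'M[R]_(n, n.+1) := \matrix_(i, l) a i l.
have : W *m A = 1%:M.
  apply/matrixP => k l; rewrite !mxE.
  have := congr1 (@^~ (c (nat_of_ord l, j0))) (wE k).
  rewrite /= row_copyE fct_sumE.
  rewrite (eq_bigr (fun i => (w k i * a i l) *: u j0)) => [|i _]; last first.
    by rewrite -[LHS]/(w k i *: b i (c (nat_of_ord l, j0))) ba scalerA.
  rewrite -scaler_suml => /eqP; rewrite -subr_eq0 -scalerBl scaler_eq0 (negPf uj0) orbF.
  rewrite subr_eq0 => /eqP E0.
  rewrite [k == l]eq_sym -val_eqE /= E0.
  by apply: eq_bigr => i _; rewrite !mxE.
move=> /(congr1 (fun M => \rank M)); rewrite mxrank1 => rk.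
have := leq_trans (mulmx_max_rank W A) (leqnn n).
by rewrite rk ltnn.
Qed.

(** A nonzero [y] has a row [a k *: u] with [a k != 0]. Rows inherit Cohen summability, and dividing
    the test functionals by [a k] would pass it on to [u]. *)
Lemma row_multiples_not_cohen y : row_multiples y -> y <> 0 -> ~ cohen p E y.
Proof.
move=> [_ [a ya]] ynz /cohenP cy; apply: u_cohen; apply/cohenP => // f [df fs].
have [k ak] : exists k, a k != 0.
  apply: contrapT => na; apply: ynz; apply/funext => i.
  rewrite -(dK i) (surjective_pairing (d i)) ya.
  suff -> : a (d i).1 = 0 by rewrite scale0r.
  by apply/eqP/negPn/negP => ai; apply: na; exists (d i).1.
have wf : weak_family q (fun j v => (a k)^-1 * f j v).
  split=> [j|v]; first exact: (dualZ (a k)^-1 (df j)).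
  apply: (fsummable_le (powR_ge0 `|(a k)^-1| q)) (fs v) => j.
  by rewrite normrM powRM.
have := cohen_family_inj q0 (h := fun j => c (k, j)) (g := fun i => (d i).2) _ (cy p1) wf.
have -> : (fun t => `|(a k)^-1 * f t ((y \o (fun j => c (k, j))) t)|) =
    (fun t => `|f t (u t)|).
  apply/funext => j /=; have [fl _] := df j.
  by rewrite ya (linfunZ fl) mulKf.
by apply=> j; rewrite cK.
Qed.

End multiples_of_a_family.

Theorem corollary3p9 (R : realType) (E : banachLatticeType R) (p : R) :
  ~ isomorphic_to_AL_space E -> 1 < p ->
  completely_latticeable (lpi p E) (pi_norm p E) (lpi p E `\` cohen p E).
Proof.
move=> nAL p1.
have p0 : 0 < p by exact: lt_trans p1.
have q1 := conjugate_exponent_ge1 p1.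
have pq := conjugate_exponentP p1.
have [c [d [cK dK]]] := nat_pair_bijection.
have [v [v0 v_pi v_cohen]] := pi_not_cohen_pair p0 q1 pq
  (rademacher_block_of_not_AL (conjugate_exponent_gt0 p1) pq nAL).
(* The bijection serves twice: here it lists the pairs indexing [v] as one sequence, and
   [row_multiples] uses it to cut sequences into rows. *)
pose u := v \o d.
have ucE : u \o c = v by apply/funext => t; rewrite /u /= cK.
have u_lpi : lpi p E u.
  apply/lpiP => //; apply: (@pi_family_supp _ _ _ _ _ c d) => [|t _|].
  - exact: can_inj cK.
  - exact: dK.
  - by rewrite ucE.
have u_cohen : ~ cohen p E u.
  move=> /cohenP cu; apply: v_cohen; rewrite -ucE.
  exact: (cohen_family_inj (conjugate_exponent_gt0 p1) cK (cu p1)).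
exists (row_multiples p c u); split.
- by move=> y [].
- by apply: row_multiples_riesz => // j; exact: v0.
- by apply: row_multiples_closed => // j; exact: v0.
- exact: (row_multiples_infinite p1 cK dK u_lpi u_cohen).
- move=> y yL ynz; split; first by case: yL.
  exact: (row_multiples_not_cohen p1 cK dK u_cohen yL ynz).
Qed.
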